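(* Let $n\ge 1$ and let $D$ and $D'$ be ordered $n$-component virtual link diagrams. If $D$ and $D'$ are welded isotopic, then for any $(m_{1},\ldots,m_{n})\in\mathbb{Z}^{n}$, the virtual link diagrams $D(m_{1},\ldots,m_{n})$ and $D'(m_{1},\ldots,m_{n})$, obtained from $D$ and $D'$ respectively by the multiplexing of all classical crossings associated with $(m_1,\ldots,m_n)$, are welded isotopic.
   Context: **Virtual link diagrams.** An $n$-component virtual link diagram is a generic immersion of $n$ circles in the plane whose singularities are finitely many transverse double points, each labeled either as a classical crossing (with over/under information) or as a virtual crossing (no over/under information). It is ordered if its components are numbered $D=D_1\cup\cdots\cup D_n$. **Welded isotopy.** Diagrams are considered up to planar isotopy. Virtual isotopy is the equivalence relation generated by the classical Reidemeister moves R1, R2, R3 (involving only classical crossings) and the virtual Reidemeister moves VR1, VR2, VR3 (the analogues of R1, R2, R3 with all crossings virtual) and VR4 (an arc having two virtual crossings with the two strands of a classical crossing, one with each strand, is slid across that classical crossing). Welded isotopy is the equivalence relation generated by virtual isotopy and the move OC (''Overcrossings Commute''): if two strands $a,b$ cross each other at a virtual crossing and a third strand $o$ passes over both $a$ and $b$ at classical crossings, the three crossings bounding a triangle, then $o$ may be slid across the virtual crossing to the other side, still passing over both $a$ and $b$. For ordered diagrams, these moves are understood to respect the ordering of components. **Multiplexing of crossings.** Let $(m_1,\ldots,m_n)\in\mathbb{Z}^n$ and let $D=D_1\cup\cdots\cup D_n$ be an ordered $n$-component virtual link diagram. Consider a classical crossing whose overpass belongs to $D_j$. In a small disk around it, use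 an orientation-preserving identification so that the overpass is a vertical straight segment and the underpass is a horizontal segment running from a point on the left of the disk boundary to a point on the right. The multiplexing of this crossing associated with $m_j$ keeps the overpass segment and replaces the underpass segment by an embedded arc with the same endpoints that zigzags monotonically upward across the vertical segment, so that the successive intersections are traversed alternately left-to-right, right-to-left, left-to-right, and so on, as follows. - If $m_j>0$: there are $2m_j-1$ intersections. The $m_j$ left-to-right ones are classical crossings at which the vertical segment is over, and the $m_j-1$ right-to-left ones are virtual crossings. - If $m_j=0$: there is a single intersection and it is a virtual crossing (the crossing is virtualized). - If $m_j<0$: there are $2|m_j|+1$ intersections. The $|m_j|$ right-to-left ones are classical crossings at which the vertical segment is over, and the $|m_j|+1$ left-to-right ones are virtual crossings. Thus $|m_j|$ classical crossings appear. With respect to any orientation of the strands, they all have the sign of the original crossing if $m_j>0$ and the opposite sign if $m_j<0$. The diagram $D(m_1,\ldots,m_n)$ is obtained from $D$ by performing this replacement at every classical crossing of $D$ (each time with the integer $m_j$ for the component $D_j$ containing the overpass), leaving virtual crossings unchanged. *)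

(* Defs.v *)
From Stdlib Require Import Relations.
From mathcomp Require Import all_boot all_order all_algebra.
From mathcomp Require Import zify.

Set Implicit Arguments.
Unset Strict Implicit.
Unset Printing Implicit Defensive.

Import Order.TTheory GRing.Theory Num.Theory.

(* Virtual link diagrams in Morse position.  A diagram in the plane that is    *)
(* generic with respect to the height function is cut by horizontal lines into *)
(* layers, each containing exactly one minimum, maximum or crossing; the other *)
(* strands of the layer are vertical.  A diagram is the word of its layers,    *)
(* read from bottom to top.  By Morse-Cerf theory every diagram has such a     *)
(* position, and two words present planar isotopic diagrams iff they are       *)
(* related by the moves [planar_move] below.  All strands carry the number     *)
(* (an element of 'I_n) of the component to which they belong.                 *)

(* The strand entering at the lower left (resp. lower right) is over; or the   *)
(* crossing is virtual.                                                        *)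
Inductive kind := OverLeft | OverRight | Virt.

Definition swap_kind (t : kind) : kind :=
  match t with OverLeft => OverRight | OverRight => OverLeft | Virt => Virt end.

Definition classical (t : kind) : bool := if t is Virt then false else true.

(* [Cross t a b]: the strand entering at the lower left belongs to component   *)
(* [a] and the strand entering at the lower right to component [b].            *)
Inductive event (n : nat) :=
  | Cup of 'I_n
  | Cap of 'I_n
  | Cross of kind & 'I_n & 'I_n.
Arguments Cross {n}.

Definition src n (e : event n) : seq 'I_n :=
  match e with Cup _ => [::] | Cap c => [:: c; c] | Cross _ a b => [:: a; b] end.

Definition tgt n (e : event n) : seq 'I_n :=
  match e with Cup c => [:: c; c] | Cap _ => [::] | Cross _ a b => [:: b; a] end.

(* [(i, e)]: the event [e] with exactly [i] vertical strands to its left.      *)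
Definition layer (n : nat) : Type := (nat * event n)%type.
Definition word (n : nat) : Type := seq (layer n).

Definition apply n (l : layer n) (s : seq 'I_n) : option (seq 'I_n) :=
  let: (i, e) := l in
  if (i <= size s) && prefix (src e) (drop i s)
  then Some (take i s ++ tgt e ++ drop (i + size (src e)) s)
  else None.

(* The component numbers of the strands on top of the word [w], when its       *)
(* bottom is [s]; [None] if the layers do not fit together.                    *)
Fixpoint run n (w : word n) (s : seq 'I_n) : option (seq 'I_n) :=
  if w is l :: w' then obind (run w') (apply l s) else Some s.

Definition closed_word n (w : word n) : bool := run w [::] == Some [::].

(* A point of a diagram is a pair [(k, p)]: the [p]-th strand met by the       *)
(* horizontal line above the first [k] layers.                                 *)
Definition level n (w : word n) (k : nat) : seq 'I_n :=
  odflt [::] (run (take k w) [::]).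

Definition on_component n (w : word n) (x : nat * nat) (j : 'I_n) : Prop :=
  onth (level w x.1) x.2 = Some j.

(* Two points are joined by a strand inside one layer. *)
Inductive joined n (w : word n) : nat * nat -> nat * nat -> Prop :=
  | joined_left k i e p : onth w k = Some (i, e) -> p < i ->
      joined w (k, p) (k.+1, p)
  | joined_right k i e p : onth w k = Some (i, e) ->
      joined w (k, i + size (src e) + p) (k.+1, i + size (tgt e) + p)
  | joined_cup k i c : onth w k = Some (i, Cup c) ->
      joined w (k.+1, i) (k.+1, i.+1)
  | joined_cap k i c : onth w k = Some (i, Cap c) ->
      joined w (k, i) (k, i.+1)
  | joined_up k i t a b : onth w k = Some (i, Cross t a b) ->
      joined w (k, i) (k.+1, i.+1)
  | joined_down k i t a b : onth w k = Some (i, Cross t a b) ->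
      joined w (k, i.+1) (k.+1, i).

Definition same_circle n (w : word n) : nat * nat -> nat * nat -> Prop :=
  clos_refl_sym_trans _ (joined w).

(* The strands numbered [j] form exactly one circle, for every [j]. *)
Definition ordered n (w : word n) : Prop :=
  forall j : 'I_n,
    (exists x, on_component w x j) /\
    (forall x y, on_component w x j -> on_component w y j -> same_circle w x y).

Record ordered_diagram (n : nat) := OrderedDiagram {
  diagram_word :> word n;
  diagram_closed : closed_word diagram_word;
  diagram_ordered : ordered diagram_word }.

(* The codimension-one events of the height function on a planar isotopy:      *)
(* exchange of the heights of two distant events, birth or death of a pair     *)
(* minimum-maximum, and passage of an extremum through a crossing.             *)
Inductive planar_move n : word n -> word n -> Prop :=
  | exchange i k e f :
      planar_move [:: (i, e); (i + size (tgt e) + k, f)]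
                  [:: (i + size (src e) + k, f); (i, e)]
  | zigzag_right i c : planar_move [:: (i.+1, Cup c); (i, Cap c)] [::]
  | zigzag_left i c : planar_move [:: (i, Cup c); (i.+1, Cap c)] [::]
  | slide_max i t a b :
      planar_move [:: (i, Cross t a b); (i.+1, Cap a)]
                  [:: (i.+1, Cross (swap_kind t) b a); (i, Cap a)]
  | slide_min i t a b :
      planar_move [:: (i, Cup a); (i.+1, Cross t a b)]
                  [:: (i.+1, Cup a); (i, Cross (swap_kind t) b a)].

(* Up to planar isotopy, these are all the positions of a curl, of a bigon and *)
(* of a triangle.                                                              *)
Definition curl n (i : nat) (t : kind) (c : 'I_n) : word n :=
  [:: (i.+1, Cup c); (i, Cross t c c); (i.+1, Cap c)].

Definition bigon n (i : nat) (t : kind) (a b : 'I_n) : word n :=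
  [:: (i, Cross t a b); (i, Cross (swap_kind t) b a)].

(* Strands [a], [b], [c] enter from left to right and leave in reverse order;  *)
(* [t1], [t2], [t3] are the kinds of the crossings a/b, a/c, b/c.              *)
Definition triangle n (i : nat) (t1 t2 t3 : kind) (a b c : 'I_n) : word n :=
  [:: (i, Cross t1 a b); (i.+1, Cross t2 a c); (i, Cross t3 b c)].

Definition triangle' n (i : nat) (t1 t2 t3 : kind) (a b c : 'I_n) : word n :=
  [:: (i.+1, Cross t3 b c); (i, Cross t2 a c); (i.+1, Cross t1 a b)].

(* The side condition of R3 excludes the two cyclic over/under patterns, in    *)
(* which no strand is on top.                                                  *)
Inductive reidemeister_move n : word n -> word n -> Prop :=
  | R1 i t c : classical t -> reidemeister_move (curl i t c) [::]
  | R2 i t a b : classical t -> reidemeister_move (bigon i t a b) [::]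
  | R3 i t1 t2 t3 a b c :
      classical t1 -> classical t2 -> classical t3 ->
      ~ (t1 = t3 /\ t2 = swap_kind t1) ->
      reidemeister_move (triangle i t1 t2 t3 a b c)
                        (triangle' i t1 t2 t3 a b c).

Inductive virtual_move n : word n -> word n -> Prop :=
  | VR1 i c : virtual_move (curl i Virt c) [::]
  | VR2 i a b : virtual_move (bigon i Virt a b) [::]
  | VR3 i a b c : virtual_move (triangle i Virt Virt Virt a b c)
                               (triangle' i Virt Virt Virt a b c)
  | VR4_ab i t a b c : classical t ->
      virtual_move (triangle i t Virt Virt a b c)
                   (triangle' i t Virt Virt a b c)
  | VR4_ac i t a b c : classical t ->
      virtual_move (triangle i Virt t Virt a b c)
                   (triangle' i Virt t Virt a b c)
  | VR4_bc i t a b c : classical t ->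
      virtual_move (triangle i Virt Virt t a b c)
                   (triangle' i Virt Virt t a b c).

(* The suffix is the strand passing over the two others. *)
Inductive overcrossings_commute n : word n -> word n -> Prop :=
  | OC_a i a b c :
      overcrossings_commute (triangle i OverLeft OverLeft Virt a b c)
                            (triangle' i OverLeft OverLeft Virt a b c)
  | OC_b i a b c :
      overcrossings_commute (triangle i OverRight Virt OverLeft a b c)
                            (triangle' i OverRight Virt OverLeft a b c)
  | OC_c i a b c :
      overcrossings_commute (triangle i Virt OverRight OverRight a b c)
                            (triangle' i Virt OverRight OverRight a b c).

Definition welded_move n (u v : word n) : Prop :=
  [\/ planar_move u v, reidemeister_move u v, virtual_move u v
    | overcrossings_commute u v].

(* Closedness of both words forces the two sides of the local move to have the *)
(* same bottom and top strands, with the same component numbers; in particular *)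
(* a step preserves [ordered].                                                 *)
Definition welded_step n (w w' : word n) : Prop :=
  closed_word w /\ closed_word w' /\
  exists p q u v, welded_move u v /\ w = p ++ u ++ q /\ w' = p ++ v ++ q.

Definition welded_isotopic n (D D' : ordered_diagram n) : Prop :=
  clos_refl_sym_trans (word n) (@welded_step n) D D'.

(* Multiplexing with [m] creates [(turns m).*2.+1] intersections. *)
Definition turns (m : int) : nat :=
  match m with Posz k => k.-1 | Negz k => k.+1 end.

(* Intersections are numbered from 0 along the zigzag, so that the even ones   *)
(* are the left-to-right ones; [t] is the kind of the original crossing.       *)
Definition zigzag_kind (m : int) (t : kind) (k : nat) : kind :=
  if (if odd k then (m < 0)%R else (0 < m)%R) then t else Virt.

(* The overpass stays a straight line transverse to [(turns m).*2.+1] parallel *)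
(* vertical pieces of the underpass, the successive pieces being connected     *)
(* alternately by minima and by maxima.  With the overpass turned to the       *)
(* vertical position and read upwards, its left side is the region above it    *)
(* if it goes from lower left to upper right ([OverLeft]), and the region      *)
(* below it if it goes from lower right to upper left ([OverRight]).           *)
Definition multiplex_layer n (m : 'I_n -> int) (l : layer n) : word n :=
  match l with
  | (i, Cross OverLeft a b) =>
      let r := turns (m a) in
      nseq r (i.+1, Cup b)
      ++ [seq (i + k, Cross (zigzag_kind (m a) OverLeft k) a b)
         | k <- iota 0 r.*2.+1]
      ++ nseq r (i.+1, Cap b)
  | (i, Cross OverRight a b) =>
      let r := turns (m b) in
      nseq r (i, Cup a)
      ++ [seq (i + (r.*2 - k), Cross (zigzag_kind (m b) OverRight k) a b)
         | k <- iota 0 r.*2.+1]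
      ++ nseq r (i.+2, Cap a)
  | _ => [:: l]
  end.

Definition multiplex_word n (m : 'I_n -> int) (w : word n) : word n :=
  flatten (map (multiplex_layer m) w).

(* Multiplexing an ordered diagram yields an ordered diagram: the new word is  *)
(* closed, and its strands numbered [j] still form one circle.                 *)

Lemma applyP n (l : layer n) s s' :
  apply l s = Some s' ->
  exists p q, [/\ size p = l.1, s = p ++ src l.2 ++ q & s' = p ++ tgt l.2 ++ q].
Proof.
case: l => i e /=; case: ifP => // /andP[les /prefixP[q defq]] [<-].
exists (take i s), q; split; first exact: size_takel.
  by rewrite -defq cat_take_drop.
by rewrite addnC -drop_drop defq drop_size_cat.
Qed.

Lemma apply_cat n (e : event n) p q :
  apply (size p, e) (p ++ src e ++ q) = Some (p ++ tgt e ++ q).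
Proof.
rewrite /= size_cat leq_addr drop_size_cat // prefix_prefix take_size_cat //=.
by rewrite addnC -drop_drop !drop_size_cat.
Qed.

Lemma run_cat n (u v : word n) s : run (u ++ v) s = obind (run v) (run u s).
Proof. by elim: u s => //= l u IHu s; case: (apply l s) => //= s'. Qed.

Lemma nseq_shift T r (c : T) q : nseq r c ++ c :: q = c :: nseq r c ++ q.
Proof. by elim: r => //= r ->. Qed.

Lemma run_cat_some n (u v : word n) s s' :
  run u s = Some s' -> run (u ++ v) s = run v s'.
Proof. by rewrite run_cat => ->. Qed.

Lemma run_cups n (c : 'I_n) r p q :
  run (nseq r (size p, Cup c)) (p ++ q) = Some (p ++ nseq r.*2 c ++ q).
Proof.
elim: r q => // r IHr q.
rewrite doubleS -[nseq r.+1 _]/((size p, Cup c) :: nseq r _) /run -/run.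
have -> := apply_cat (Cup c) p q.
by rewrite [obind _ _]/= IHr !nseq_shift.
Qed.

Lemma run_caps n (c : 'I_n) r p q :
  run (nseq r (size p, Cap c)) (p ++ nseq r.*2 c ++ q) = Some (p ++ q).
Proof.
elim: r q => // r IHr q.
rewrite doubleS -[nseq r.+1 _]/((size p, Cap c) :: nseq r _) /run -/run.
have -> := apply_cat (Cap c) p (nseq r.*2 c ++ q).
exact: IHr.
Qed.

Lemma run_rightward n (K : nat -> kind) (a b : 'I_n) i N x p q :
  size p = i + x ->
  run [seq (i + k, Cross (K k) a b) | k <- iota x N] (p ++ a :: nseq N b ++ q)
  = Some (p ++ nseq N b ++ a :: q).
Proof.
elim: N x p => // N IHN x p sp.
rewrite -[iota x N.+1]/(x :: iota x.+1 N) map_cons /run -/run -sp.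
have -> := apply_cat (Cross (K x) a b) p (nseq N b ++ q).
have := IHN x.+1 (rcons p b); rewrite size_rcons sp addnS => /(_ erefl).
by rewrite !cat_rcons /= => ->.
Qed.

Lemma run_leftward n (K : nat -> kind) (a b : 'I_n) N M x p q :
  M.+1 = x + N ->
  run [seq (size p + (M - k), Cross (K k) a b) | k <- iota x N]
      (p ++ nseq N a ++ b :: q)
  = Some (p ++ b :: nseq N a ++ q).
Proof.
elim: N x q => // N IHN x q defM.
rewrite -[iota x N.+1]/(x :: iota x.+1 N) map_cons /run -/run.
have -> : size p + (M - x) = size (p ++ nseq N a).
  by rewrite size_cat size_nseq; lia.
have := apply_cat (Cross (K x) a b) (p ++ nseq N a) q.
rewrite -!catA /= nseq_shift => ->.
by rewrite [obind _ _]/= IHN ?addSnnS // !nseq_shift.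
Qed.

Lemma run_multiplex_layer n (m : 'I_n -> int) (l : layer n) s s' :
  apply l s = Some s' -> run (multiplex_layer m l) s = Some s'.
Proof.
move=> ls; have [p [q [sp defs defs']]] := applyP ls.
case: l => i [c|c|[] a b] in ls sp defs defs' *; rewrite /multiplex_layer;
  try (by rewrite -[LHS]/(obind (run [::]) (apply _ s)) ls); rewrite /= in sp defs defs'; subst i s s'.
- have := run_cups b (turns (m a)) (rcons p a) (b :: q).
  rewrite size_rcons !cat_rcons nseq_shift => /run_cat_some ->.
  have := @run_rightward _ (zigzag_kind (m a) OverLeft) a b (size p)
    (turns (m a)).*2.+1 0 p q.
  rewrite addn0 => /(_ erefl)/run_cat_some ->.
  have := run_caps b (turns (m a)) (rcons p b) (a :: q).
  by rewrite size_rcons !cat_rcons.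
- have := run_cups a (turns (m b)) p (a :: b :: q).
  rewrite nseq_shift => /run_cat_some ->.
  have := @run_leftward _ (zigzag_kind (m b) OverRight) a b
    (turns (m b)).*2.+1 (turns (m b)).*2 0 p q erefl.
  move=> /run_cat_some ->.
  have := run_caps a (turns (m b)) (p ++ [:: b; a]) q.
  by rewrite -!catA size_cat addn2.
Qed.

Lemma run_multiplex n (m : 'I_n -> int) (w : word n) s s' :
  run w s = Some s' -> run (multiplex_word m w) s = Some s'.
Proof.
elim: w s => //= l w IHw s; case ls: (apply l s) => [s1|] //= ws1.
by rewrite /multiplex_word /= run_cat (run_multiplex_layer _ ls) [obind _ _]/= IHw.
Qed.

Lemma multiplex_closed n (m : 'I_n -> int) (w : word n) :
  closed_word w -> closed_word (multiplex_word m w).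
Proof. by move=> /eqP cw; rewrite /closed_word (run_multiplex _ cw). Qed.

Section Circles.
Variable n : nat.
Implicit Types (w u v : word n) (l : layer n).

Let sc w (k p k' p' : nat) := same_circle w (k, p) (k', p').

Lemma sc_refl w k p : sc w k p k p. Proof. exact: rst_refl. Qed.
Lemma sc_sym w k p k' p' : sc w k p k' p' -> sc w k' p' k p.
Proof. exact: rst_sym. Qed.
Lemma sc_trans w k' p' k p k2 p2 :
  sc w k p k' p' -> sc w k' p' k2 p2 -> sc w k p k2 p2.
Proof. exact: rst_trans. Qed.
Lemma sc_cast w a b c d a' b' c' d' :
  sc w a b c d -> a = a' -> b = b' -> c = c' -> d = d' -> sc w a' b' c' d'.
Proof. by move=> h <- <- <- <-. Qed.

Lemma joined_cat w u v x y : joined w x y ->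
  joined (u ++ w ++ v) (size u + x.1, x.2) (size u + y.1, y.2).
Proof.
have H k l : onth w k = Some l -> onth (u ++ w ++ v) (size u + k) = Some l.
  move=> e; have := onthTE w k; rewrite e => kw.
  by rewrite onth_cat ltnNge leq_addr /= addKn onth_cat -kw.
case=> k i => [e p|e p|c|c|t a b|t a b] /H h /=; rewrite ?addnS.
- exact: joined_left h.
- exact: joined_right h.
- exact: joined_cup h.
- exact: joined_cap h.
- exact: joined_up h.
- exact: joined_down h.
Qed.

Lemma sc_cat u v w k p k' p' :
  sc w k p k' p' -> sc (u ++ w ++ v) (size u + k) p (size u + k') p'.
Proof.
suff H x y : same_circle w x y ->
    same_circle (u ++ w ++ v) (size u + x.1, x.2) (size u + y.1, y.2) by move/H.
elim=> [{}x {}y /joined_cat h|{}x|{}x {}y _|{}x {}y z _ + _].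
- exact/rst_step/h.
- exact: rst_refl.
- exact: rst_sym.
- exact: rst_trans.
Qed.

Lemma sc_catl v w k p k' p' : sc w k p k' p' -> sc (w ++ v) k p k' p'.
Proof. exact: (sc_cat [::]). Qed.

Lemma sc_catr u w k p k' p' :
  sc w k p k' p' -> sc (u ++ w) (size u + k) p (size u + k') p'.
Proof. by move/(sc_cat u [::]); rewrite cats0. Qed.

(* Every point above a crossing or a maximum is joined to one below. *)
Lemma joined_below w k i e p : onth w k = Some (i, e) -> src e != [::] ->
  exists p', sc w k p' k.+1 p.
Proof.
move=> h ne; case: (ltnP p i) => [lpi|lip].
  by exists p; apply/rst_step/(joined_left h).
case: (ltnP p (i + size (tgt e))) => [|le].
  case: e h ne => [c|c|t a b] //= h _; first by lia.
  move=> lt; have [->|->] : p = i \/ p = i.+1 by lia.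
    by exists i.+1; apply/rst_step/(joined_down h).
  by exists i; apply/rst_step/(joined_up h).
exists (i + size (src e) + (p - (i + size (tgt e)))).
by rewrite -{2}(subnKC le); apply/rst_step/(joined_right _ h).
Qed.

Lemma all_below w d p :
  (forall k, k < size w -> exists i e, onth w k = Some (i, e) /\ src e != [::]) ->
  d <= size w -> exists p', sc w 0 p' d p.
Proof.
move=> H; elim: d p => [|d IHd] p ld; first by exists p; apply: sc_refl.
have [i [e [h ne]]] := H _ ld; have [p1 h1] := joined_below p h ne.
have [p2 h2] := IHd p1 (ltnW ld).
by exists p2; apply: sc_trans h1.
Qed.

Section Cups.
Variables (r i : nat) (c : 'I_n).
Let w : word n := nseq r (i, Cup c).

Lemma cups_left d p : d <= r -> p < i -> sc w 0 p d p.
Proof.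
elim: d => [|d IHd] ld lp; first exact: sc_refl.
have h : onth w d = Some (i, Cup c) by rewrite onth_nseq ld.
by apply: sc_trans (IHd (ltnW ld) lp) _; apply/rst_step/(joined_left h).
Qed.

Lemma cups_right m d q : d + m = r -> sc w d (i + q) r (i + q + m.*2).
Proof.
elim: m d q => [|m IHm] d q dm.
  by apply: sc_cast (sc_refl w d (i + q)) _ _ _ _; lia.
have ld : d < r by lia.
have h : onth w d = Some (i, Cup c) by rewrite onth_nseq ld.
apply: (@sc_trans w d.+1 (i + q.+2)); last first.
  by apply: sc_cast (IHm d.+1 q.+2 _) _ _ _ _; lia.
apply: sc_cast (_ : sc w d (i + 0 + q) d.+1 (i + 2 + q)) _ _ _ _; try lia.
by apply/rst_step/(joined_right _ h).
Qed.

Lemma cups_pair q : q < r -> sc w r (i + q.*2) r (i + q.*2.+1).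
Proof.
move=> lq; have ld : r - q.+1 < r by lia.
have h : onth w (r - q.+1) = Some (i, Cup c) by rewrite onth_nseq ld.
have e : (r - q.+1).+1 = r - q by lia.
apply: (@sc_trans w (r - q) (i + 0)).
  by apply: sc_sym; apply: sc_cast (@cups_right q (r - q) 0 _) _ _ _ _; lia.
apply: (@sc_trans w (r - q) (i + 1)); last first.
  by apply: sc_cast (@cups_right q (r - q) 1 _) _ _ _ _; lia.
by rewrite -e addn0 addn1; apply/rst_step/(joined_cup h).
Qed.

End Cups.

Section Caps.
Variables (r i : nat) (c : 'I_n).
Let w : word n := nseq r (i, Cap c).

Lemma caps_left d p : d <= r -> p < i -> sc w 0 p d p.
Proof.
elim: d => [|d IHd] ld lp; first exact: sc_refl.
have h : onth w d = Some (i, Cap c) by rewrite onth_nseq ld.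
by apply: sc_trans (IHd (ltnW ld) lp) _; apply/rst_step/(joined_left h).
Qed.

Lemma caps_right d q : d <= r -> sc w 0 (i + q + d.*2) d (i + q).
Proof.
elim: d q => [|d IHd] q ld.
  by apply: sc_cast (sc_refl w 0 (i + q)) _ _ _ _; lia.
have h : onth w d = Some (i, Cap c) by rewrite onth_nseq ld.
apply: (@sc_trans w d (i + q.+2)).
  by apply: sc_cast (IHd q.+2 _) _ _ _ _; lia.
apply: sc_cast (_ : sc w d (i + 2 + q) d.+1 (i + 0 + q)) _ _ _ _; try lia.
by apply/rst_step/(joined_right _ h).
Qed.

Lemma caps_pair q : q < r -> sc w 0 (i + q.*2) 0 (i + q.*2.+1).
Proof.
move=> lq; have h : onth w q = Some (i, Cap c) by rewrite onth_nseq lq.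
apply: (@sc_trans w q (i + 0)).
  by apply: sc_cast (caps_right 0 (ltnW lq)) _ _ _ _; lia.
apply: (@sc_trans w q (i + 1)); last first.
  by apply/sc_sym; apply: sc_cast (caps_right 1 (ltnW lq)) _ _ _ _; lia.
by rewrite addn0 addn1; apply/rst_step/(joined_cap h).
Qed.

End Caps.

(* A strand crossing [N] parallel strands from left to right. *)
Section Rightward.
Variables (N i : nat) (K : nat -> kind) (a b : 'I_n).
Let w : word n := [seq (i + k, Cross (K k) a b) | k <- iota 0 N].

Lemma rightward_onth d : d < N -> onth w d = Some (i + d, Cross (K d) a b).
Proof. by move=> ld; rewrite onthE -map_comp (nth_map 0) ?size_iota // nth_iota. Qed.

Lemma rightward_out d p : d <= N -> (p < i) || (i + N < p) -> sc w 0 p d p.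
Proof.
elim: d => [|d IHd] ld lp; first exact: sc_refl.
apply: sc_trans (IHd (ltnW ld) lp) _; have h := rightward_onth ld.
case: (ltnP p i) lp => [lt _|le /= lt].
  by apply/rst_step/(joined_left h); lia.
apply: sc_cast (_ : sc w d (i + d + 2 + (p - (i + d + 2)))
                      d.+1 (i + d + 2 + (p - (i + d + 2)))) _ _ _ _; try lia.
by apply/rst_step/(joined_right _ h).
Qed.

Lemma rightward_over d : d <= N -> sc w 0 i d (i + d).
Proof.
elim: d => [|d IHd] ld; first by rewrite addn0; apply: sc_refl.
apply: sc_trans (IHd (ltnW ld)) _; rewrite addnS.
exact/rst_step/(joined_up (rightward_onth ld)).
Qed.

Lemma rightward_before d q : d <= q -> q < N -> sc w 0 (i.+1 + q) d (i.+1 + q).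
Proof.
elim: d => [|d IHd] ld lq; first exact: sc_refl.
apply: sc_trans (IHd (ltnW ld) lq) _.
have h : onth w d = _ := rightward_onth (ltn_trans ld lq).
apply: sc_cast (_ : sc w d (i + d + 2 + (q - d.+1))
                      d.+1 (i + d + 2 + (q - d.+1))) _ _ _ _; try lia.
by apply/rst_step/(joined_right _ h).
Qed.

Lemma rightward_under q : q < N -> sc w 0 (i.+1 + q) N (i + q).
Proof.
move=> lq; suff H d : q < d -> d <= N -> sc w 0 (i.+1 + q) d (i + q) by exact: H.
elim: d => // d IHd; rewrite ltnS leq_eqVlt => /orP[/eqP <- _|lqd ld].
  apply: sc_trans (rightward_before (leqnn _) lq) _; rewrite addSn.
  exact/rst_step/(joined_down (rightward_onth lq)).
apply: sc_trans (IHd lqd (ltnW ld)) _.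
by apply/rst_step/(joined_left (rightward_onth ld)); lia.
Qed.

Lemma rightward_below d p : d <= N -> exists p', sc w 0 p' d p.
Proof.
move=> ld; apply: all_below; rewrite size_map size_iota // => k lk.
by exists (i + k), (Cross (K k) a b); rewrite rightward_onth.
Qed.

End Rightward.

Section Leftward.
Variables (M i : nat) (K : nat -> kind) (a b : 'I_n).
Let w : word n := [seq (i + (M - k), Cross (K k) a b) | k <- iota 0 M.+1].

Lemma leftward_onth d : d <= M -> onth w d = Some (i + (M - d), Cross (K d) a b).
Proof. by move=> ld; rewrite onthE -map_comp (nth_map 0) ?size_iota // nth_iota. Qed.

Lemma leftward_out d p : d <= M.+1 -> (p < i) || (i + M.+1 < p) -> sc w 0 p d p.
Proof.
elim: d => [|d IHd] ld lp; first exact: sc_refl.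
apply: sc_trans (IHd (ltnW ld) lp) _; have h := leftward_onth ld.
case: (ltnP p i) lp => [lt _|le /= lt].
  by apply/rst_step/(joined_left h); lia.
apply: sc_cast (_ : sc w d (i + (M - d) + 2 + (p - (i + (M - d) + 2)))
                d.+1 (i + (M - d) + 2 + (p - (i + (M - d) + 2)))) _ _ _ _; try lia.
by apply/rst_step/(joined_right _ h).
Qed.

Lemma leftward_over d : d <= M.+1 -> sc w 0 (i + M.+1) d (i + (M.+1 - d)).
Proof.
elim: d => [|d IHd] ld; first exact: sc_refl.
apply: sc_trans (IHd (ltnW ld)) _; rewrite subSS (@subSn d M ld) addnS.
exact/rst_step/(joined_down (leftward_onth ld)).
Qed.

Lemma leftward_before d q : d + q <= M -> sc w 0 (i + q) d (i + q).
Proof.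
elim: d => [|d IHd] ld; first exact: sc_refl.
have ld' : d <= M by lia.
apply: sc_trans (IHd _) _; first by lia.
by apply/rst_step/(joined_left (leftward_onth ld')); lia.
Qed.

Lemma leftward_under q : q <= M -> sc w 0 (i + q) M.+1 (i + q).+1.
Proof.
move=> lq; suff H d : M - q < d -> d <= M.+1 -> sc w 0 (i + q) d (i + q).+1.
  by apply: H; lia.
elim: d => // d IHd; rewrite ltnS leq_eqVlt => /orP[/eqP <- _|lqd ld].
  apply: (@sc_trans w (M - q) (i + q)); first by apply: leftward_before; lia.
  have h : onth w (M - q) = _ := leftward_onth (leq_subr q M).
  by rewrite subKn // in h; apply/rst_step/(joined_up h).
apply: sc_trans (IHd lqd (ltnW ld)) _.
have h : onth w d = _ := leftward_onth ld.
apply: sc_cast (_ : sc w d (i + (M - d) + 2 + (q + d - M.+1))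
                d.+1 (i + (M - d) + 2 + (q + d - M.+1))) _ _ _ _; try lia.
by apply/rst_step/(joined_right _ h).
Qed.

Lemma leftward_below d p : d <= M.+1 -> exists p', sc w 0 p' d p.
Proof.
move=> ld; apply: all_below; rewrite size_map size_iota // => k lk.
by exists (i + (M - k)), (Cross (K k) a b); rewrite leftward_onth.
Qed.

End Leftward.

Lemma caps_below r i (c : 'I_n) d p : d <= r ->
  exists p', sc (nseq r (i, Cap c)) 0 p' d p.
Proof.
move=> ld; apply: all_below; rewrite size_nseq // => k lk.
by exists i, (Cap c); rewrite onth_nseq lk.
Qed.

(* [B] connects the points at its bottom and at its top like the layer [l],    *)
(* and has no circle in its interior.                                          *)
Definition simulates l (B : word n) : Prop :=
  (forall k p k' p', joined [:: l] (k, p) (k', p') ->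
     sc B (if k == 0 then 0 else size B) p (if k' == 0 then 0 else size B) p') /\
  (forall d p, d <= size B ->
     exists2 e, e = 0 \/ e = size B & exists p', sc B d p e p').

Lemma simulates_self l : simulates l [:: l].
Proof.
split=> [k p k' p' h|d p]; last first.
  by case: d => [|[|//]] _; [exists 0|exists 1]; auto; exists p; apply: sc_refl.
have lt k0 l0 : onth [:: l] k0 = Some l0 -> k0 = 0.
  by case: k0 => // k0; rewrite /= onth0n.
have H x y : joined [:: l] x y -> x.1 <= 1 /\ y.1 <= 1.
  by case=> [? ? ? ?|? ? ? ?|? ? ?|? ? ?|? ? ? ? ?|? ? ? ? ?] /lt ->.
have /= [] := H _ _ h; case: k h => [|[|//]] h _; case: k' h => [|[|//]] h _;
  exact: rst_step.
Qed.

Lemma joined_crossP i t a b x y :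
  @joined n [:: (i, Cross t a b)] x y ->
  [/\ x.1 = 0, y.1 = 1 & [\/ x.2 < i /\ y.2 = x.2, i.+1 < x.2 /\ y.2 = x.2,
                          x.2 = i /\ y.2 = i.+1 | x.2 = i.+1 /\ y.2 = i]].
Proof.
have lt k0 l0 : onth [:: (i, Cross t a b)] k0 = Some l0 ->
    k0 = 0 /\ l0 = (i, Cross t a b).
  by case: k0 => [[]|k0]; rewrite /= ?onth0n.
case=> [k j e p|k j e p|k j c|k j c|k j t' a' b'|k j t' a' b'] /lt[-> []] //= ->.
- by move=> _ lp; split=> //; constructor 1.
- by move=> ->; split=> //; constructor 2; rewrite /=; lia.
- by move=> *; split=> //; constructor 3.
- by move=> *; split=> //; constructor 4.
Qed.

Lemma simulates_rightward (m : 'I_n -> int) i a b :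
  simulates (i, Cross OverLeft a b) (multiplex_layer m (i, Cross OverLeft a b)).
Proof.
rewrite /multiplex_layer; set r := turns (m a); set N := r.*2.+1.
set A := nseq r (i.+1, Cup b); set C := nseq r (i.+1, Cap b).
set X := [seq _ | k <- _].
have sA : size A = r by rewrite size_nseq.
have sX : size X = N by rewrite size_map size_iota.
have sC : size C = r by rewrite size_nseq.
set B := A ++ X ++ C.
have sB : size B = r + (N + r) by rewrite !size_cat sA sX sC.
have inA k p k' p' : sc A k p k' p' -> sc B k p k' p' by apply: sc_catl.
have inX k p k' p' : sc X k p k' p' -> sc B (r + k) p (r + k') p'.
  by move=> h; have := sc_cat A C h; rewrite sA.
have inC k p k' p' : sc C k p k' p' -> sc B (r + N + k) p (r + N + k') p'.
  by move=> h; have := sc_catr (A ++ X) h; rewrite size_cat sA sX -catA.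
have inX0 k p p' : sc X 0 p k p' -> sc B r p (r + k) p'.
  by move/inX; rewrite addn0.
have inC0 k p p' : sc C 0 p k p' -> sc B (r + N) p (r + N + k) p'.
  by move/inC; rewrite addn0.
have leftA p : p < i.+1 -> sc B 0 p r p.
  by move=> lp; apply/inA/cups_left.
have rightA q : sc B 0 (i.+1 + q) r (i.+1 + q + r.*2).
  by apply/inA/cups_right.
have under q : q < N -> sc B r (i.+1 + q) r i.+1.
  elim: q => [|q IHq] lq; first by rewrite addn0; apply: sc_refl.
  apply: sc_trans (IHq (ltnW lq)); apply: sc_sym.
  have eq := odd_double_half q; case: (odd q) eq => eq.
    apply: (@sc_trans B (r + N) (i + q)); first exact/inX0/rightward_under/ltnW.
    apply: (@sc_trans B (r + N) (i + q.+1)); last first.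
      exact/sc_sym/inX0/rightward_under.
    apply: sc_cast (_ : sc B (r + N + 0) (i.+1 + q./2.*2)
       (r + N + 0) (i.+1 + q./2.*2.+1)) _ _ _ _; try lia.
    by apply/inC/caps_pair; lia.
  apply: sc_cast (_ : sc B r (i.+1 + q./2.*2) r (i.+1 + q./2.*2.+1)) _ _ _ _; try lia.
  by apply/inA/cups_pair; lia.
have first_last : sc B 0 i.+1 r i.+1.
  apply: sc_trans (under r.*2 _); last by [].
  by apply: sc_cast (rightA 0) _ _ _ _; lia.
have bottom p : exists p', sc B 0 p' r p.
  case: (ltnP p i.+1) => [lp|le]; first by exists p; apply: leftA.
  case: (ltnP p (i.+1 + N)) => [lt|ge].
    exists i.+1; apply: sc_trans first_last _; apply: sc_sym.
    by apply: sc_cast (under (p - i.+1) _) _ _ _ _; lia.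
  exists (p - r.*2); apply: sc_cast (rightA (p - r.*2 - i.+1)) _ _ _ _; lia.
split=> [k p k' p' /joined_crossP /= [-> -> /=]|d p].
  rewrite sB => -[[lp ->]|[lp ->]|[-> ->]|[-> ->]].
  - apply: sc_trans (leftA _ (ltnW lp)) _.
    apply: (@sc_trans B (r + N) p).
      by apply/inX0/rightward_out; rewrite ?lp.
    by rewrite addnA; apply/inC0/caps_left=> //; apply: ltnW.
  - apply: (@sc_trans B r (p + r.*2)).
      by apply: sc_cast (rightA (p - i.+1)) _ _ _ _; lia.
    apply: (@sc_trans B (r + N) (p + r.*2)).
      by apply/inX0/rightward_out => //; lia.
    rewrite addnA; apply/inC0.
    by apply: sc_cast (@caps_right r i.+1 b r (p - i.+1) _) _ _ _ _; lia.
  - apply: sc_trans (leftA _ (leqnn _)) _.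
    apply: (@sc_trans B (r + N) (i + N)); first exact/inX0/rightward_over.
    rewrite addnA; apply/inC0.
    by apply: sc_cast (@caps_right r i.+1 b r 0 _) _ _ _ _; lia.
  - apply: sc_trans first_last _.
    apply: (@sc_trans B (r + N) i).
      apply: sc_cast (inX0 N (i.+1 + 0) (i + 0) _) _ _ _ _; try lia.
      exact: rightward_under.
    by rewrite addnA; apply/inC0/caps_left.
rewrite sB => ld; exists 0; first by left.
suff [p' h] : exists p', sc B 0 p' d p by exists p'; apply: sc_sym.
case: (leqP d r) => [ldr|lrd].
  case: (ltnP p i.+1) => [lp|le].
    by exists p; apply/inA/cups_left.
  have [p' h] := bottom (i.+1 + (p - i.+1) + (r - d).*2); exists p'.
  apply: sc_trans h _; apply/sc_sym/inA.
  by apply: sc_cast (@cups_right r i.+1 b (r - d) d (p - i.+1) _) _ _ _ _; lia.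
have [p1 h1] : exists p1, sc B r p1 d p; last first.
  by have [p' h] := bottom p1; exists p'; apply: sc_trans h1.
have upX e q : e <= N -> exists p1, sc B r p1 (r + e) q.
  by move=> le; have [p1 h1] := rightward_below i (zigzag_kind (m a) OverLeft) a b q le;
     exists p1; apply: inX0.
case: (leqP d (r + N)) => [ldN|lNd].
  have [|p1 h1] := upX (d - r) p; first by lia.
  by exists p1; rewrite subnKC // ltnW in h1.
have [|p2 h2] := @caps_below r i.+1 b (d - (r + N)) p; first by lia.
have [//|p1 h1] := upX N p2; exists p1; apply: sc_trans h1 _.
by apply: sc_cast (inC0 _ _ _ h2) _ _ _ _; lia.
Qed.

Lemma simulates_leftward (m : 'I_n -> int) i a b :
  simulates (i, Cross OverRight a b) (multiplex_layer m (i, Cross OverRight a b)).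
Proof.
rewrite /multiplex_layer; set r := turns (m b); set M := r.*2; set N := M.+1.
set A := nseq r (i, Cup a); set C := nseq r (i.+2, Cap a).
set X := [seq _ | k <- _].
have sA : size A = r by rewrite size_nseq.
have sX : size X = N by rewrite size_map size_iota.
have sC : size C = r by rewrite size_nseq.
set B := A ++ X ++ C.
have sB : size B = r + (N + r) by rewrite !size_cat sA sX sC.
have inA k p k' p' : sc A k p k' p' -> sc B k p k' p' by apply: sc_catl.
have inX k p k' p' : sc X k p k' p' -> sc B (r + k) p (r + k') p'.
  by move=> h; have := sc_cat A C h; rewrite sA.
have inC k p k' p' : sc C k p k' p' -> sc B (r + N + k) p (r + N + k') p'.
  by move=> h; have := sc_catr (A ++ X) h; rewrite size_cat sA sX -catA.
have inX0 k p p' : sc X 0 p k p' -> sc B r p (r + k) p'.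
  by move/inX; rewrite addn0.
have inC0 k p p' : sc C 0 p k p' -> sc B (r + N) p (r + N + k) p'.
  by move/inC; rewrite addn0.
have leftA p : p < i -> sc B 0 p r p.
  by move=> lp; apply/inA/cups_left.
have rightA q : sc B 0 (i + q) r (i + q + r.*2).
  by apply/inA/cups_right.
have under q : q < N -> sc B r (i + q) r i.
  elim: q => [|q IHq] lq; first by rewrite addn0; apply: sc_refl.
  apply: sc_trans (IHq (ltnW lq)); apply: sc_sym.
  have eq := odd_double_half q; case: (odd q) eq => eq.
    apply: (@sc_trans B (r + N) (i + q).+1); first by apply/inX0/leftward_under; lia.
    apply: (@sc_trans B (r + N) (i + q.+1).+1); last first.
      exact/sc_sym/inX0/leftward_under.
    apply: sc_cast (_ : sc B (r + N + 0) (i.+2 + q./2.*2)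
       (r + N + 0) (i.+2 + q./2.*2.+1)) _ _ _ _; try lia.
    by apply/inC/caps_pair; lia.
  apply: sc_cast (_ : sc B r (i + q./2.*2) r (i + q./2.*2.+1)) _ _ _ _; try lia.
  by apply/inA/cups_pair; lia.
have first_last : sc B 0 i r i.
  apply: sc_trans (under r.*2 _); last by [].
  by apply: sc_cast (rightA 0) _ _ _ _; lia.
have bottom p : exists p', sc B 0 p' r p.
  case: (ltnP p i) => [lp|le]; first by exists p; apply: leftA.
  case: (ltnP p (i + N)) => [lt|ge].
    exists i; apply: sc_trans first_last _; apply: sc_sym.
    by apply: sc_cast (under (p - i) _) _ _ _ _; lia.
  exists (p - r.*2); apply: sc_cast (rightA (p - r.*2 - i)) _ _ _ _; lia.
split=> [k p k' p' /joined_crossP /= [-> -> /=]|d p].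
  rewrite sB => -[[lp ->]|[lp ->]|[-> ->]|[-> ->]].
  - apply: sc_trans (leftA _ lp) _.
    apply: (@sc_trans B (r + N) p).
      by apply/inX0/leftward_out; rewrite ?lp.
    by rewrite addnA; apply/inC0/caps_left=> //; lia.
  - apply: (@sc_trans B r (p + r.*2)).
      by apply: sc_cast (rightA (p - i)) _ _ _ _; lia.
    apply: (@sc_trans B (r + N) (p + r.*2)).
      by apply/inX0/leftward_out => //; lia.
    rewrite addnA; apply/inC0.
    by apply: sc_cast (@caps_right r i.+2 a r (p - i.+2) _) _ _ _ _; lia.
  - apply: sc_trans first_last _.
    apply: sc_trans (sc_sym (under M _)) _; first by [].
    apply: (@sc_trans B (r + N) (i + M).+1); first exact/inX0/leftward_under.
    apply: (@sc_trans B (r + N) i.+1); last first.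
      by rewrite addnA; apply/inC0/caps_left.
    apply: sc_trans (sc_sym (inX0 _ _ _ (leftward_under _ _ _ _ (leqnn M)))) _.
    apply: sc_trans (under M _) _; first by [].
    by apply: sc_cast (inX0 _ _ _ (leftward_under _ _ _ _ (leq0n M))) _ _ _ _; lia.
  - apply: (@sc_trans B r (i + M.+1)).
      by apply: sc_cast (rightA 1) _ _ _ _; lia.
    apply: (@sc_trans B (r + N) i).
      by apply: sc_cast (inX0 _ _ _ (leftward_over _ _ _ _ (leqnn M.+1))) _ _ _ _; lia.
    by rewrite addnA; apply/inC0/caps_left=> //; lia.
rewrite sB => ld; exists 0; first by left.
suff [p' h] : exists p', sc B 0 p' d p by exists p'; apply: sc_sym.
case: (leqP d r) => [ldr|lrd].
  case: (ltnP p i) => [lp|le].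
    by exists p; apply/inA/cups_left.
  have [p' h] := bottom (i + (p - i) + (r - d).*2); exists p'.
  apply: sc_trans h _; apply/sc_sym/inA.
  by apply: sc_cast (@cups_right r i a (r - d) d (p - i) _) _ _ _ _; lia.
have [p1 h1] : exists p1, sc B r p1 d p; last first.
  by have [p' h] := bottom p1; exists p'; apply: sc_trans h1.
have upX e q : e <= N -> exists p1, sc B r p1 (r + e) q.
  by move=> le; have [p1 h1] := leftward_below i (zigzag_kind (m b) OverRight) a b q le;
     exists p1; apply: inX0.
case: (leqP d (r + N)) => [ldN|lNd].
  have [|p1 h1] := upX (d - r) p; first by lia.
  by exists p1; rewrite subnKC // ltnW in h1.
have [|p2 h2] := @caps_below r i.+2 a (d - (r + N)) p; first by lia.
have [//|p1 h1] := upX N p2; exists p1; apply: sc_trans h1 _.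
by apply: sc_cast (inC0 _ _ _ h2) _ _ _ _; lia.
Qed.

Lemma multiplex_simulates (m : 'I_n -> int) l : simulates l (multiplex_layer m l).
Proof.
case: l => i [c|c|[] a b]; try exact: simulates_self.
  exact: simulates_rightward.
exact: simulates_leftward.
Qed.

Section Multiplex.
Variable m : 'I_n -> int.

(* The level of the multiplexed word corresponding to the level [k] of [w]. *)
Let f w k := size (multiplex_word m (take k w)).

Lemma multiplex_cat u v :
  multiplex_word m (u ++ v) = multiplex_word m u ++ multiplex_word m v.
Proof. by rewrite /multiplex_word map_cat flatten_cat. Qed.

Lemma joined_layer w k p k' p' : joined w (k, p) (k', p') ->
  exists k0 l d d', [/\ onth w k0 = Some l, k = k0 + d, k' = k0 + d',
     d <= 1 /\ d' <= 1 & joined [:: l] (d, p) (d', p')].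
Proof.
suff H x y : joined w x y -> exists k0 l d d', [/\ onth w k0 = Some l,
     x.1 = k0 + d, y.1 = k0 + d', d <= 1 /\ d' <= 1
   & joined [:: l] (d, x.2) (d', y.2)] by move/H.
case=> {}k i => [e q|e q|c|c|t a b|t a b] h.
- by move=> lq; exists k, (i, e), 0, 1; rewrite addn0 addn1; split=> //; apply: (@joined_left _ _ 0 i e).
- by exists k, (i, e), 0, 1; rewrite addn0 addn1; split=> //; apply: (@joined_right _ _ 0 i e).
- by exists k, (i, Cup c), 1, 1; rewrite addn1; split=> //; apply: (@joined_cup _ _ 0 i c).
- by exists k, (i, Cap c), 0, 0; rewrite addn0; split=> //; apply: (@joined_cap _ _ 0 i c).
- by exists k, (i, Cross t a b), 0, 1; rewrite addn0 addn1; split=> //; apply: (@joined_up _ _ 0 i t a b).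
- by exists k, (i, Cross t a b), 0, 1; rewrite addn0 addn1; split=> //; apply: (@joined_down _ _ 0 i t a b).
Qed.

Lemma onth_split w k l : onth w k = Some l -> w = take k w ++ l :: drop k.+1 w.
Proof.
move=> h; have := onthTE w k; rewrite h => /esym lk.
by rewrite -{1}(cat_take_drop k w) (drop_nth l lk) (@onth_nth _ l _ _ _ h).
Qed.

Lemma multiplex_joined w x y : joined w x y ->
  same_circle (multiplex_word m w) (f w x.1, x.2) (f w y.1, y.2).
Proof.
case: x y => [k p] [k' p'] /joined_layer [k0 [l [d [d' [h -> -> [ld ld'] hl]]]]] /=.
have fS e : e <= 1 ->
    f w (k0 + e) = f w k0 + (if e == 0 then 0 else size (multiplex_layer m l)).
  case: e => [|[|//]] _; first by rewrite !addn0.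
  have := onthTE w k0; rewrite h => /esym lk.
  rewrite addn1 /f (take_nth l lk) (@onth_nth _ l _ _ _ h) -cats1 multiplex_cat size_cat.
  by rewrite /multiplex_word /= cats0.
rewrite !fS // {1}(onth_split h) -cat1s !multiplex_cat.
apply: sc_cat; rewrite /multiplex_word /= cats0.
exact: (multiplex_simulates m l).1.
Qed.

Lemma multiplex_same_circle w x y : same_circle w x y ->
  same_circle (multiplex_word m w) (f w x.1, x.2) (f w y.1, y.2).
Proof.
elim=> [{}x {}y /multiplex_joined //|{}x|{}x {}y _|{}x {}y z _ + _].
- exact: rst_refl.
- exact: rst_sym.
- exact: rst_trans.
Qed.

Lemma multiplex_reach w K p : K <= size (multiplex_word m w) ->
  exists k p', k <= size w /\ sc (multiplex_word m w) K p (f w k) p'.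
Proof.
elim: w K => [|l w IHw] K.
  rewrite leqn0 => /eqP ->; exists 0, p; split=> //; exact: sc_refl.
rewrite -cat1s multiplex_cat; set B := multiplex_word m [:: l].
have BE : B = multiplex_layer m l by rewrite /B /multiplex_word /= cats0.
have f1 k : f ([:: l] ++ w) k.+1 = size B + f w k.
  by rewrite /f cat1s /= -cat1s multiplex_cat size_cat.
rewrite size_cat => lK; case: (leqP K (size B)) => [leK|ltK].
  have [|e He [p' h]] := (multiplex_simulates m l).2 K p; first by rewrite -BE.
  rewrite -BE in h He; case: He => e0; rewrite e0 in h.
    exists 0, p'; split=> //; rewrite /f take0; exact: sc_catl.
  exists 1, p'; split=> //; rewrite f1 /f take0 addn0; exact: sc_catl.
have [|k [p' [lk h]]] := IHw (K - size B); first by lia.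
exists k.+1, p'; split=> //; rewrite f1.
by apply: sc_cast (sc_catr B h) _ _ _ _; lia.
Qed.

End Multiplex.

Lemma level_step w k l : closed_word w -> onth w k = Some l ->
  apply l (level w k) = Some (level w k.+1).
Proof.
move=> /eqP cw h; have := onthTE w k; rewrite h => /esym lk.
move: cw; rewrite {1}(onth_split h) run_cat /level (take_nth l lk) (@onth_nth _ l _ _ _ h).
rewrite -cats1 run_cat; case: (run _ _) => //= s.
by case: (apply l s).
Qed.

Lemma joined_component w x y j : closed_word w -> joined w x y ->
  on_component w x j <-> on_component w y j.
Proof.
move=> cw; rewrite /on_component.
have shift (u v : seq 'I_n) k : onth (u ++ v) (size u + k) = onth v k.
  by rewrite onth_cat ltnNge leq_addr addKn.
case=> k i => [e q|e q|c|c|t a b|t a b] h; have /applyP := level_step cw h;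
  move=> [u [v [su e1 e2]]]; cbn [fst snd tgt src] in *; rewrite ?e1 ?e2 -su.
- by move=> lq; rewrite !onth_cat lq.
- by rewrite !catA !onth_cat !size_cat !ltnNge !leq_addr /= !addKn.
- by rewrite -(addn0 (size u)) -addnS !shift.
- by rewrite -(addn0 (size u)) -addnS !shift.
- by rewrite -(addn0 (size u)) -addnS !shift.
- by rewrite -(addn0 (size u)) -addnS !shift.
Qed.

Lemma same_circle_component w x y j : closed_word w -> same_circle w x y ->
  on_component w x j <-> on_component w y j.
Proof.
move=> cw; elim=> [{}x {}y|{}x|{}x {}y _|{}x {}y z _ + _]; last 3 first.
- by [].
- by move=> ->.
- by move=> ->.
exact: joined_component.
Qed.

Lemma multiplex_level m w k : closed_word w ->
  level (multiplex_word m w) (size (multiplex_word m (take k w))) = level w k.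
Proof.
move=> /eqP; rewrite -{1 2}(cat_take_drop k w) multiplex_cat run_cat /level.
rewrite take_size_cat //; case h: (run (take k w) _) => [s|] // _.
by rewrite (run_multiplex _ h).
Qed.

Lemma multiplex_ordered (m : 'I_n -> int) w :
  closed_word w -> ordered w -> ordered (multiplex_word m w).
Proof.
move=> cw ow j; have [[x0 hx0] circ] := ow j; have cW := multiplex_closed m cw.
have comp x : on_component (multiplex_word m w)
    (size (multiplex_word m (take x.1 w)), x.2) j <-> on_component w x j.
  by rewrite /on_component /= multiplex_level.
split; first by exists (size (multiplex_word m (take x0.1 w)), x0.2); apply/comp.
have reach x : on_component (multiplex_word m w) x j ->
    exists2 y, on_component w y j & same_circle (multiplex_word m w) x
      (size (multiplex_word m (take y.1 w)), y.2).
  case: x => K p hx; case: (leqP K (size (multiplex_word m w))) => [lK|gK].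
    have [k [p' [_ h]]] := multiplex_reach p lK; exists (k, p') => //.
    by apply/comp; rewrite -(same_circle_component j cW h).
  move: hx; rewrite /on_component /level /= take_oversize ?(ltnW gK) //.
  by rewrite (eqP cW) /= onth0n.
move=> x y /reach[x' hx' sx] /reach[y' hy' sy].
apply: rst_trans sx _; apply: rst_trans (rst_sym _ _ _ _ sy).
exact/multiplex_same_circle/circ.
Qed.

End Circles.

Definition multiplex n (m : 'I_n -> int) (D : ordered_diagram n) :
    ordered_diagram n :=
  OrderedDiagram (multiplex_closed m (diagram_closed D))
                 (multiplex_ordered m (diagram_closed D) (diagram_ordered D)).

(* Main.v *)
Require Import Defs.
From Stdlib Require Import Relations.
From mathcomp Require Import all_boot all_order all_algebra.
From mathcomp Require Import zify.

(* A classical crossing followed by a virtual crossing of the same two strands *)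
(* is a pure tangle P, so that a classical crossing is P v with v virtual, and *)
(* multiplexing turns it into P^m v (if the underpass zigzags against the      *)
(* overpass, OC is needed to reverse the order of the overcrossings).  Write   *)
(* P_xy for this tangle when x passes over y.  Virtual moves let every v be    *)
(* pulled to the top of a triangle, after which OC says that P_xy and P_xz     *)
(* commute, and R3 says that P_xy P_xz commutes with P_yz.  Hence              *)
(* (P_xy)^k (P_xz)^k = (P_xy P_xz)^k commutes with (P_yz)^l, which is R3 for   *)
(* multiplexed crossings.  Sliding a P past an extremum of the underpass gives *)
(* the inverse tangle, by which a multiplexed crossing slides past an extremum *)
(* exactly as the original one; R1 is then a sequence of kinks.                *)

(** On a fixed list of strands, pure tangles up to welded isotopy multiply as in a group, with
    [gen true] and [gen false] inverse to each other. By [layer_multi], multiplexing replaces a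
    crossing P v by P^m v, with an exponent that depends only on the component passing over. So
    every generating move has to be turned into a relation that survives this replacement.

    For triangles, [triangle_rel] turns R3 into A B C = C B A and OC into a commutation. The two
    tangles in which the top strand is over get the same exponent and commute, so [pow_top],
    [pow_middle] and [pow_bottom] carry the relation to powers; [multi_triangle] collects the cases.
    Bigons hold because conjugation by a virtual crossing inverts a generator ([twist_bigon]), and
    curls because a maximum absorbs kinks one by one ([twist_kink]). For extrema ([multi_slide_max])
    the algebra serves when the capped strand is under, and the geometry of the zigzag when it is
    over.

    All of this is done for the local relation [weq]; [translates_welded_move] and [weq_welded]
    bring it back to closed diagrams. *)

Set Implicit Arguments.
Unset Strict Implicit.
Unset Printing Implicit Defensive.

(** * Local welded equivalence *)

Section Local.
Variable n : nat.
Implicit Types (u v w x y : word n) (s p q z : seq 'I_n) (a b c d : 'I_n).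

Definition shift k w : word n := [seq (k + l.1, l.2) | l <- w].

Lemma shift_cat k u v : shift k (u ++ v) = shift k u ++ shift k v.
Proof. exact: map_cat. Qed.

Lemma shift0 w : shift 0 w = w.
Proof. by rewrite /shift; elim: w => //= -[i e] w ->. Qed.

Lemma shift_shift j k w : shift j (shift k w) = shift (j + k) w.
Proof. by rewrite /shift -map_comp; apply: eq_map => -[i e] /=; rewrite addnA. Qed.

Lemma shift_nseq j k (l : layer n) : shift j (nseq k l) = nseq k (j + l.1, l.2).
Proof. exact: map_nseq. Qed.

Lemma apply_shift p s (l : layer n) :
  Defs.apply (size p + l.1, l.2) (p ++ s) = omap (cat p) (Defs.apply l s).
Proof.
case: l => i e; rewrite /Defs.apply /= size_cat leq_add2l.
rewrite drop_cat takeD ltnNge leq_addr /= addKn take_size_cat // drop_size_cat //.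
by case: ifP => //= _; rewrite -catA -addnA drop_cat ltnNge leq_addr /= addKn.
Qed.

Lemma run_shift p s w : run (shift (size p) w) (p ++ s) = omap (cat p) (run w s).
Proof.
elim: w s => // l w IHw s.
rewrite -[LHS]/(obind (run (shift (size p) w)) (Defs.apply (size p + l.1, l.2) (p ++ s))).
rewrite apply_shift /run -/run.
by case: (Defs.apply l s) => //= s1; rewrite IHw.
Qed.

Lemma run_right w s s' z : run w s = Some s' -> run w (s ++ z) = Some (s' ++ z).
Proof.
elim: w s => [|l w IHw] s /=; first by case=> ->.
case ls: (Defs.apply l s) => [s1|] //= /IHw <-.
have [p [q [sp -> ->]]] := applyP ls.
by rewrite -!catA; have := apply_cat l.2 p (q ++ z); rewrite sp -surjective_pairing => ->.
Qed.

Lemma run_local p z w s s' :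
  run w s = Some s' -> run (shift (size p) w) (p ++ s ++ z) = Some (p ++ s' ++ z).
Proof. by move=> h; rewrite run_shift (run_right z h). Qed.

(* The moves are only used where they fit the strands [s]; the strands [z] on  *)
(* the right make the relation stable under enlarging the diagram sideways.    *)
Inductive local_step s u v : Prop :=
  LocalStep w1 w2 x y of welded_move x y & u = w1 ++ x ++ w2 & v = w1 ++ y ++ w2
    & forall z, run u (s ++ z) = run v (s ++ z).

Definition weq s : word n -> word n -> Prop :=
  clos_refl_sym_trans _ (local_step s).

Lemma weq_refl s u : weq s u u. Proof. exact: rst_refl. Qed.
Lemma weq_sym s u v : weq s u v -> weq s v u. Proof. exact: rst_sym. Qed.
Lemma weq_trans s v u w : weq s u v -> weq s v w -> weq s u w.
Proof. exact: rst_trans. Qed.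

Lemma weq_run s z u v : weq s u v -> run u (s ++ z) = run v (s ++ z).
Proof. by elim=> [{}u {}v []|//|{}u {}v _|{}u v' {}v _ + _] //; congruence. Qed.

Lemma weq_move s x y :
  welded_move x y -> (forall z, run x (s ++ z) = run y (s ++ z)) -> weq s x y.
Proof.
move=> xy r; apply: rst_step.
by apply: (LocalStep xy _ _ r (w1 := [::]) (w2 := [::])); rewrite cats0.
Qed.

Lemma weq_left s0 s w u v :
  run w s0 = Some s -> weq s u v -> weq s0 (w ++ u) (w ++ v).
Proof.
move=> rw; elim=> [{}u {}v [p q x y xy -> -> r]|{}u|{}u {}v _|{}u v' {}v _ + _].
- apply: rst_step; apply: (LocalStep xy (w1 := w ++ p) (w2 := q)); rewrite -?catA // => z.
  by rewrite !(run_cat w) !(run_right z rw) /=.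
- exact: rst_refl.
- exact: rst_sym.
- exact: rst_trans.
Qed.

Lemma weq_right s u v w : weq s u v -> weq s (u ++ w) (v ++ w).
Proof.
elim=> [{}u {}v [p q x y xy -> -> r]|{}u|{}u {}v _|{}u v' {}v _ + _].
- apply: rst_step; apply: (LocalStep xy (w1 := p) (w2 := q ++ w)); rewrite -?catA // => z.
  by have := r z; rewrite !catA !(run_cat _ w) => ->.
- exact: rst_refl.
- exact: rst_sym.
- exact: rst_trans.
Qed.

Lemma welded_move_shift k x y :
  welded_move x y -> welded_move (shift k x) (shift k y).
Proof.
case=> [[]|[]|[]|[]] *; rewrite /shift /= ?addnA ?addnS;
  first [ by constructor 1; constructor | by constructor 2; constructor
        | by constructor 3; constructor | by constructor 4; constructor ].
Qed.

Lemma weq_shift p z s u v :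
  weq s u v -> weq (p ++ s ++ z) (shift (size p) u) (shift (size p) v).
Proof.
elim=> [{}u {}v [p' q x y xy -> -> r]|{}u|{}u {}v _|{}u v' {}v _ + _].
- rewrite !shift_cat; apply: rst_step.
  apply: (LocalStep (welded_move_shift (size p) xy) erefl erefl) => z'.
  by rewrite -!catA -!shift_cat !run_shift r.
- exact: rst_refl.
- exact: rst_sym.
- exact: rst_trans.
Qed.

Lemma weq_at p s z s0 pre x y post :
  run pre s0 = Some (p ++ s ++ z) -> weq s x y ->
  weq s0 (pre ++ shift (size p) x ++ post) (pre ++ shift (size p) y ++ post).
Proof. by move=> r xy; apply: weq_left r _; apply/weq_right/weq_shift. Qed.

(** With an empty bottom, the agreement of runs in each local step carries closedness along the
    chain, as [welded_step] demands. *)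
Lemma weq_welded u v : weq [::] u v -> closed_word u ->
  closed_word v /\ clos_refl_sym_trans _ (@welded_step n) u v.
Proof.
move=> uv cu; suff H u' v' : weq [::] u' v' -> closed_word u' = closed_word v' /\
  (closed_word u' -> clos_refl_sym_trans _ (@welded_step n) u' v').
  by have [<- ?] := H _ _ uv; split; auto.
elim=> {u v uv cu u' v'} [u v [p q x y xy uE vE r]|u|u v _ [-> IH]|u v w _ [e1 IH1] _ [e2 IH2]].
- have uv : closed_word u = closed_word v.
    by rewrite /closed_word; have := r [::]; rewrite /= => ->.
  split=> // cu; apply: rst_step; split=> //; split; first by rewrite -uv.
  by exists p, q, x, y.
- by split=> // _; apply: rst_refl.
- by split=> // cv; apply: rst_sym; apply: IH.
- by rewrite e1; split=> // cv; apply: (rst_trans _ _ _ v); [apply: IH1; rewrite e1 | apply: IH2].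
Qed.

Lemma run1 (l : layer n) s : run [:: l] s = Defs.apply l s.
Proof. by rewrite /=; case: (Defs.apply l s). Qed.

Lemma run_far s1 s1' s2 s2' u v z :
  run u s1 = Some s1' -> run v s2 = Some s2' ->
  run (u ++ shift (size s1') v) (s1 ++ s2 ++ z) =
  run (shift (size s1) v ++ u) (s1 ++ s2 ++ z).
Proof.
move=> us vs; rewrite !run_cat (run_right _ us) [LHS]/= !run_shift (run_right z vs).
by rewrite [RHS]/= (run_right _ us).
Qed.

Lemma weq_far1 s1 s1' s2 s2' (l l' : layer n) :
  Defs.apply l s1 = Some s1' -> Defs.apply l' s2 = Some s2' ->
  weq (s1 ++ s2) ([:: l] ++ shift (size s1') [:: l']) (shift (size s1) [:: l'] ++ [:: l]).
Proof.
move=> h1 h2; apply: weq_move => [|z]; last first.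
  by rewrite -catA; apply: run_far; rewrite run1; [exact: h1 | exact: h2].
have [p [q [/= sp e1 e1']]] := applyP h1; constructor 1.
case: l l' sp e1 e1' {h1 h2} => i e [j f] /= sp -> ->.
by rewrite !size_cat sp !addnA -!(addnA (i + _)); apply: exchange.
Qed.

(** Induction on the layers of both words from [exchange]. The two shifts differ because [u] may
    change the number of strands to the left of [v]. *)
Lemma weq_far s1 s1' s2 s2' u v :
  run u s1 = Some s1' -> run v s2 = Some s2' ->
  weq (s1 ++ s2) (u ++ shift (size s1') v) (shift (size s1) v ++ u).
Proof.
elim: u s1 => [|l u IHu] s1.
  by move=> [->] _; rewrite cats0; apply: weq_refl.
rewrite -[run _ _]/(obind (run u) (Defs.apply l s1)).
case ls: (Defs.apply l s1) => [s|] // us vs.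
apply: (@weq_trans _ ([:: l] ++ shift (size s) v ++ u)).
  apply: (@weq_left _ (s ++ s2) [:: l] (u ++ _)); last exact: IHu.
  by apply: run_right; rewrite run1.
suff H : weq (s1 ++ s2) ([:: l] ++ shift (size s) v) (shift (size s1) v ++ [:: l]).
  by have := weq_right u H; rewrite -!catA.
elim: v {IHu us} s2 vs => [|l' v IHv] s2; first by move=> _; apply: weq_refl.
rewrite -[run _ _]/(obind (run v) (Defs.apply l' s2)).
case ls': (Defs.apply l' s2) => [s'|] // vs.
have h := weq_far1 ls ls'.
rewrite -(cat1s l' v) !shift_cat.
apply: (@weq_trans _ (shift (size s1) [:: l'] ++ [:: l] ++ shift (size s) v)).
  by rewrite !catA; apply: weq_right.
rewrite -!catA; apply: weq_left (IHv _ vs).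
by rewrite run_shift run1 ls'.
Qed.
End Local.

(** * Tactics for rewriting inside words *)

Arguments shift : simpl never.

Lemma shift_cons n k i (e : event n) w : shift k ((i, e) :: w) = (k + i, e) :: shift k w.
Proof. by []. Qed.

Lemma shift_nil n k : shift k [::] = [::] :> word n.
Proof. by []. Qed.

Lemma weq_rw n p s z s0 (pre x y post u w : word n) :
  weq s x y -> run pre s0 = Some (p ++ s ++ z) ->
  u = pre ++ shift (size p) x ++ post ->
  weq s0 (pre ++ shift (size p) y ++ post) w -> weq s0 u w.
Proof. by move=> xy r -> h; apply: weq_trans (weq_at _ r xy) h. Qed.

(** Stands for the strands to the left of a rewriting: only their number is given, and unification
    finds their components. *)
Ltac holes k :=
  lazymatch k with
  | O => uconstr:(nil)
  | S ?k' => let r := holes k' in uconstr:(cons _ r)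
  end.

Ltac run_simpl := repeat (progress (rewrite /= ?eqxx ?drop0 ?take0 ?prefix0s ?cats0)).

Ltac run_block :=
  match goal with
  | |- context [run (?u ++ ?v) ?s] => rewrite (run_cat u v s)
  | H : run ?Y ?s = Some ?s' |- context [run (shift ?k ?Y) ?S] =>
      let h := holes k in let E := fresh in
      eassert (E : run (shift k Y) S = Some _) by exact (@run_local _ h _ _ _ _ H);
      rewrite E; clear E
  | H : run ?Y ?s = Some ?s' |- context [run ?Y ?S] =>
      let E := fresh in
      eassert (E : run Y S = Some _) by exact (@run_right _ _ _ _ _ H);
      rewrite E; clear E
  end.

Ltac run_tac :=
  intros; run_simpl; repeat (progress (run_block; run_simpl)); reflexivity.

Ltac norm_word :=
  cbn [size];
  repeat match goal with
  | |- context [(?u ++ ?v) ++ ?w] => rewrite -(catA u v w)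
  | |- context [(?l :: ?v) ++ ?w] => rewrite (cat_cons l v w)
  | |- context [nil ++ ?w] => rewrite (cat0s w)
  | |- context [shift 0 ?w] => rewrite (shift0 w)
  | |- context [?u ++ nil] => rewrite (cats0 u)
  | |- context [shift ?k (?u ++ ?v)] => rewrite (shift_cat k u v)
  | |- context [shift ?k ((?i, ?e) :: ?w)] => rewrite (shift_cons k i e w)
  | |- context [shift ?k nil] => rewrite (shift_nil _ k)
  | |- context [shift ?j (shift ?k ?w)] => rewrite (shift_shift j k w)
  end;
  rewrite ?addSn ?add0n.

Ltac split_items k u :=
  lazymatch k with
  | O => let T := type of u in constr:((@nil _ : T, u))
  | S ?k' => lazymatch u with
    | ?l :: ?r => lazymatch split_items k' r with (?p, ?q) => constr:((l :: p, q)) end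
    | ?A ++ ?r => lazymatch split_items k' r with (?p, ?q) => constr:((A ++ p, q)) end
    | ?A => let T := type of u in constr:((A, @nil _ : T))
    end
  end.

(* [step k j p H] rewrites with [H] the items number k, ..., k + j - 1 of the    *)
(* word on the left-hand side, where an item is a layer or an operand of [++]  *)
(* and [p] is the number of strands to the left of those of [H]; [step0] is    *)
(* the case where [H] is about all the strands, whose list may be a variable.  *)
Ltac step k j p H :=
  norm_word;
  lazymatch goal with |- weq ?s0 ?u ?w =>
  lazymatch split_items k u with (?pre, ?u1) =>
  lazymatch split_items j u1 with (_, ?post) =>
  let h := holes p in
  eapply (@weq_rw _ h _ _ s0 pre _ _ post u w H);
    [ run_tac | solve [norm_word; reflexivity] | norm_word ]
  end end end.

Lemma weq_rw0 n s s0 (pre x y post u w : word n) :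
  weq s x y -> run pre s0 = Some s -> u = pre ++ x ++ post ->
  weq s0 (pre ++ y ++ post) w -> weq s0 u w.
Proof.
by move=> xy r -> h; apply: weq_trans h; apply: weq_left r _; apply: weq_right.
Qed.

Ltac run_endo :=
  repeat match goal with
  | |- context [run (?u ++ ?v) ?s] => rewrite (run_cat u v s)
  | h : run ?u ?s = Some _ |- context [run ?u ?s] => rewrite h
  | |- context [obind ?f (Some ?x)] => change (obind f (Some x)) with (f x); cbv beta
  end; first [reflexivity | run_tac].

Ltac step0 k j H :=
  norm_word;
  lazymatch goal with |- weq ?s0 ?u ?w =>
  lazymatch split_items k u with (?pre, ?u1) =>
  lazymatch split_items j u1 with (_, ?post) =>
  eapply (@weq_rw0 _ _ s0 pre _ _ post u w H);
    [ run_endo | solve [norm_word; reflexivity] | norm_word ]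
  end end end.

(** * Elementary moves, kinks and extrema *)

Notation X i t a b := (i, Cross t a b).
Notation V i a b := (i, Cross Virt a b).

Section Basic.
Variable n : nat.
Implicit Types (a b c d : 'I_n) (t : kind).

Lemma swap_kindK t : swap_kind (swap_kind t) = t. Proof. by case: t. Qed.

Lemma weq_zigzag_left c : weq [:: c] [:: (0, Cup c); (1, Cap c)] [::].
Proof. by apply: weq_move => [|z]; [constructor 1; apply: zigzag_left | run_tac]. Qed.

Lemma weq_zigzag_right c : weq [:: c] [:: (1, Cup c); (0, Cap c)] [::].
Proof. by apply: weq_move => [|z]; [constructor 1; apply: zigzag_right | run_tac]. Qed.

Lemma weq_slide_max t a b : weq [:: a; b; a] [:: X 0 t a b; (1, Cap a)]
  [:: X 1 (swap_kind t) b a; (0, Cap a)].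
Proof. by apply: weq_move => [|z]; [constructor 1; apply: slide_max | run_tac]. Qed.

Lemma weq_slide_min t a b : weq [:: b] [:: (0, Cup a); X 1 t a b]
  [:: (1, Cup a); X 0 (swap_kind t) b a].
Proof. by apply: weq_move => [|z]; [constructor 1; apply: slide_min | run_tac]. Qed.

Lemma weq_curl t c : weq [:: c] [:: (1, Cup c); X 0 t c c; (1, Cap c)] [::].
Proof.
apply: weq_move => [|z]; last by run_tac.
by case: t; [constructor 2; apply: R1 | constructor 2; apply: R1 | constructor 3; apply: VR1].
Qed.

Lemma weq_bigon t a b : weq [:: a; b] [:: X 0 t a b; X 0 (swap_kind t) b a] [::].
Proof.
apply: weq_move => [|z]; last by run_tac.
by case: t; [constructor 2; apply: R2 | constructor 2; apply: R2 | constructor 3; apply: VR2].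
Qed.

Lemma virtual_bigon a b : weq [:: a; b] [:: V 0 a b; V 0 b a] [::].
Proof. exact: (weq_bigon Virt). Qed.

Lemma weq_exchange (e f : event n) s : weq (src e ++ s ++ src f)
  [:: (0, e); (size (tgt e) + size s, f)] [:: (size (src e) + size s, f); (0, e)].
Proof.
have := @weq_far _ (src e) (tgt e) (s ++ src f) (s ++ tgt f) [:: (0, e)] [:: (size s, f)].
apply.
  by have := apply_cat e [::] [::]; rewrite run1 !cats0.
by have := apply_cat f s [::]; rewrite run1 !cats0.
Qed.

(** [Z] is a curl turned over by [slide_min]. Planted on the right leg of the maximum, its minimum
    cancels against that maximum and leaves its crossing under its own maximum. *)
Lemma kink_cap t c : weq [:: c; c] [:: X 0 t c c; (0, Cap c)] [:: (0, Cap c)].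
Proof.
have Z : weq [:: c] [::] [:: (0, Cup c); X 1 t c c; (1, Cap c)].
  step 0 0 0 (weq_sym (weq_curl (swap_kind t) c)).
  step 0 2 0 (weq_sym (weq_slide_min t c c)).
  exact: weq_refl.
apply: weq_sym.
step 0 0 1 Z.
step 2 2 0 (weq_sym (@weq_exchange (Cap c) (Cap c) [::])).
step 1 2 0 (weq_sym (@weq_exchange (Cap c) (Cross t c c) [::])).
step 0 2 0 (weq_zigzag_right c).
exact: weq_refl.
Qed.

Lemma slide_min_of_max a b (Y Y' : word n) :
  run Y [:: a; b] = Some [:: b; a] -> run Y' [:: b; a] = Some [:: a; b] ->
  weq [:: a; b; a] (Y ++ [:: (1, Cap a)]) (shift 1 Y' ++ [:: (0, Cap a)]) ->
  weq [:: b] ((0, Cup a) :: shift 1 Y) ((1, Cup a) :: Y').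
Proof.
move=> rY rY' h.
have rY1 := run_local [:: a] [::] rY.
step 2 0 2 (weq_sym (weq_zigzag_right a)).
have h1 : weq [:: a; b] (Y ++ [:: (2, Cup a)]) ((2, Cup a) :: Y).
  have := @weq_far _ [:: a; b] [:: b; a] [::] [:: a; a] Y [:: (0, Cup a)] rY erefl.
  exact.
step 1 2 1 h1.
step 2 2 1 h.
step 0 2 0 (@weq_exchange (Cup a) (Cup a) [:: b]).
have h2 : weq [:: b; a] ((0, Cup a) :: shift 2 Y') (Y' ++ [:: (0, Cup a)]).
  have := @weq_far _ [::] [:: a; a] [:: b; a] [:: a; b] [:: (0, Cup a)] Y' erefl rY'.
  by rewrite shift0.
step 1 2 0 h2.
step 2 2 0 (weq_zigzag_left a).
exact: weq_refl.
Qed.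

End Basic.

(** * Pure tangles on two strands *)

Section Pure.
Variable n : nat.
Implicit Types (a b c d : 'I_n) (t : kind) (u v w : word n) (s : seq 'I_n).

Definition pow k w : word n := flatten (nseq k w).

Lemma powS k w : pow k.+1 w = w ++ pow k w. Proof. by []. Qed.

Lemma run_pow k w s : run w s = Some s -> run (pow k w) s = Some s.
Proof. by move=> h; elim: k => //= k IHk; rewrite powS run_cat h. Qed.

Lemma shift_pow j k w : shift j (pow k w) = pow k (shift j w).
Proof. by elim: k => //= k IHk; rewrite !powS shift_cat IHk. Qed.

Lemma pow_conj k s u v w :
  run u s = Some s -> weq s (v ++ w) (u ++ v) ->
  weq s (v ++ pow k w) (pow k u ++ v).
Proof.
move=> ru h; elim: k => [|k IHk]; first by rewrite cats0; apply: weq_refl.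
rewrite !powS.
step0 0 2 h.
step0 1 2 IHk.
exact: weq_refl.
Qed.

Lemma pow_comm k s u v :
  run u s = Some s -> run v s = Some s ->
  weq s (v ++ u) (u ++ v) -> weq s (v ++ pow k u) (pow k u ++ v).
Proof. by move=> ru rv; apply: pow_conj. Qed.

Lemma inv_comm s u u' v :
  run u s = Some s -> run u' s = Some s -> run v s = Some s ->
  weq s (u ++ u') [::] -> weq s (u' ++ u) [::] ->
  weq s (v ++ u) (u ++ v) -> weq s (v ++ u') (u' ++ v).
Proof.
move=> ru ru' rv uu' u'u h.
step0 0 0 (weq_sym u'u).
step0 1 2 (weq_sym h).
step0 2 2 uu'.
exact: weq_refl.
Qed.

Lemma pow_mul k s u v :
  run u s = Some s -> run v s = Some s ->
  weq s (v ++ u) (u ++ v) -> weq s (pow k (u ++ v)) (pow k u ++ pow k v).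
Proof.
move=> ru rv h; elim: k => [|k IHk]; first exact: weq_refl.
rewrite !powS -!catA.
have rp := run_pow k ru.
step0 2 1 IHk.
step0 1 2 (pow_comm k ru rv h).
exact: weq_refl.
Qed.

(** VR3 and VR4 in one statement: the moving strand meets only virtual crossings, so the third
    crossing may have any kind. The next two lemmas cover the other positions of that crossing. *)
Lemma detour_bc t a b c : weq [:: a; b; c] [:: V 0 a b; V 1 a c; X 0 t b c]
  [:: X 1 t b c; V 0 a c; V 1 a b].
Proof.
apply: weq_move => [|z]; last by run_tac.
by constructor 3; case: t; [apply: VR4_bc|apply: VR4_bc|apply: VR3].
Qed.

Lemma detour_ab t a b c : weq [:: a; b; c] [:: X 0 t a b; V 1 a c; V 0 b c]
  [:: V 1 b c; V 0 a c; X 1 t a b].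
Proof.
apply: weq_move => [|z]; last by run_tac.
by constructor 3; case: t; [apply: VR4_ab|apply: VR4_ab|apply: VR3].
Qed.

Lemma detour_ac t a b c : weq [:: a; b; c] [:: V 0 a b; X 1 t a c; V 0 b c]
  [:: V 1 b c; X 0 t a c; V 1 a b].
Proof.
apply: weq_move => [|z]; last by run_tac.
by constructor 3; case: t; [apply: VR4_ac|apply: VR4_ac|apply: VR3].
Qed.

Definition pure t1 t2 a b : word n := [:: X 0 t1 a b; X 0 t2 b a].
Definition far_pure t1 t2 a b c : word n :=
  [:: V 0 a b; X 1 t1 a c; X 1 t2 c a; V 0 b a].

Lemma run_pure t1 t2 a b : run (pure t1 t2 a b) [:: a; b] = Some [:: a; b].
Proof. by run_tac. Qed.

Lemma run_far_pure t1 t2 a b c :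
  run (far_pure t1 t2 a b c) [:: a; b; c] = Some [:: a; b; c].
Proof. by run_tac. Qed.

Lemma pull_bc t1 t2 a b c : weq [:: a; b; c]
  ([:: V 0 a b; V 1 a c] ++ pure t1 t2 b c)
  (shift 1 (pure t1 t2 b c) ++ [:: V 0 a b; V 1 a c]).
Proof.
rewrite /pure /=.
step 0 3 0 (detour_bc t1 a b c).
step 1 3 0 (detour_bc t2 a c b).
exact: weq_refl.
Qed.

Lemma pull_ab t1 t2 a b c : weq [:: a; b; c]
  ([:: V 1 b c; V 0 a c] ++ shift 1 (pure t1 t2 a b))
  (pure t1 t2 a b ++ [:: V 1 b c; V 0 a c]).
Proof.
rewrite /pure; norm_word.
step 0 3 0 (weq_sym (detour_ab t1 a b c)).
step 1 3 0 (weq_sym (detour_ab t2 b a c)).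
exact: weq_refl.
Qed.

Lemma pull_ac t1 t2 a b c : weq [:: a; b; c]
  (V 0 a b :: shift 1 (pure t1 t2 a c)) (far_pure t1 t2 a b c ++ [:: V 0 a b]).
Proof.
rewrite /pure /far_pure; norm_word; apply: weq_sym.
step 3 2 0 (virtual_bigon b a).
exact: weq_refl.
Qed.

(** Strands [a] and [c] can be made adjacent by moving [b] to the left or to the right; two detours
    show that the resulting tangle is the same. *)
Lemma pull_ac' t1 t2 a b c : weq [:: a; b; c]
  (V 1 b c :: pure t1 t2 a c) (far_pure t1 t2 a b c ++ [:: V 1 b c]).
Proof.
rewrite /pure /far_pure; norm_word; apply: weq_sym.
step 2 0 0 (weq_sym (virtual_bigon b c)).
step 0 3 0 (detour_ac t1 a b c).
step 3 3 0 (detour_ac t2 c b a).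
step 2 2 1 (virtual_bigon a b).
step 3 2 1 (virtual_bigon c b).
exact: weq_refl.
Qed.

(* [gen e] and [gen (~~ e)] are inverse to each other, and [gen true t] is the *)
(* tangle P; [far_gen] is the same tangle on the outer two of three strands.   *)
Definition gen (e : bool) t a b : word n :=
  if e then pure t Virt a b else pure Virt (swap_kind t) a b.
Definition far_gen (e : bool) t a b c : word n :=
  if e then far_pure t Virt a b c else far_pure Virt (swap_kind t) a b c.

Lemma run_gen e t a b : run (gen e t a b) [:: a; b] = Some [:: a; b].
Proof. by case: e; apply: run_pure. Qed.

Lemma run_far_gen e t a b c :
  run (far_gen e t a b c) [:: a; b; c] = Some [:: a; b; c].
Proof. by case: e; apply: run_far_pure. Qed.

Lemma gen_inv e t a b : weq [:: a; b] (gen e t a b ++ gen (~~ e) t a b) [::].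
Proof.
case: e; rewrite /gen /pure /=.
  step 1 2 0 (virtual_bigon b a).
  step 0 2 0 (weq_bigon t a b).
  exact: weq_refl.
have h := weq_bigon (swap_kind t) b a; rewrite swap_kindK in h.
step 1 2 0 h.
step 0 2 0 (virtual_bigon a b).
exact: weq_refl.
Qed.

Lemma far_gen_inv e t a b c :
  weq [:: a; b; c] (far_gen e t a b c ++ far_gen (~~ e) t a b c) [::].
Proof.
have h := gen_inv e t a c; case: e h; rewrite /gen /pure /far_gen /far_pure /= => h.
  step 3 2 0 (virtual_bigon b a).
  step 1 4 1 h.
  step 0 2 0 (virtual_bigon a b).
  exact: weq_refl.
step 3 2 0 (virtual_bigon b a).
step 1 4 1 h.
step 0 2 0 (virtual_bigon a b).
exact: weq_refl.
Qed.

(* Conjugating by a virtual crossing exchanges the strands of a generator: the *)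
(* overpass becomes the right strand and the sign of the crossing changes.     *)
Lemma gen_virt e t a b :
  weq [:: a; b] (gen e t a b ++ [:: V 0 a b]) (V 0 a b :: gen (~~ e) (swap_kind t) b a).
Proof.
case: e; rewrite /gen /pure /= ?swap_kindK; last exact: weq_refl.
step 1 2 0 (virtual_bigon b a); apply: weq_sym.
step 0 2 0 (virtual_bigon a b).
exact: weq_refl.
Qed.

(** The normal form P^k v or P^-k v of a multiplexed crossing; [k = 0] gives the virtual
    crossing. *)
Definition twist e k t a b : word n := pow k (gen e t a b) ++ [:: V 0 a b].

Lemma cross_twist t a b : weq [:: a; b] [:: X 0 t a b] (twist true 1 t a b).
Proof.
rewrite /twist /= /gen /pure; norm_word; apply: weq_sym.
step 1 2 0 (virtual_bigon b a).
exact: weq_refl.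
Qed.

Section Triangle.
Variables (a b c : 'I_n) (e1 e2 e3 : bool) (k1 k2 k3 : nat) (t1 t2 t3 : kind).
Let A := gen e1 t1 a b.
Let B := far_gen e2 t2 a b c.
Let C := shift 1 (gen e3 t3 b c).
Let W := [:: V 0 a b; V 1 a c; V 0 b c].

Let rA : run A [:: a; b; c] = Some [:: a; b; c].
Proof. exact: (run_right [:: c] (run_gen e1 t1 a b)). Qed.
Let rB : run B [:: a; b; c] = Some [:: a; b; c].
Proof. exact: run_far_gen. Qed.
Let rC : run C [:: a; b; c] = Some [:: a; b; c].
Proof. by have := run_local [:: a] [::] (run_gen e3 t3 b c). Qed.

(** Pulling the virtual crossings to the top leaves a product of pure tangles on strands in the
    fixed order [a], [b], [c]. *)
Lemma triangle_pull : weq [:: a; b; c]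
  (twist e1 k1 t1 a b ++ shift 1 (twist e2 k2 t2 a c) ++ twist e3 k3 t3 b c)
  (pow k1 A ++ pow k2 B ++ pow k3 C ++ W).
Proof.
have rpA := run_pow k1 rA; have rpB := run_pow k2 rB; have rpC := run_pow k3 rC.
rewrite /twist !shift_cat !shift_pow; norm_word.
have h2 : weq [:: a; b; c] ([:: V 0 a b] ++ shift 1 (gen e2 t2 a c)) (B ++ [:: V 0 a b]).
  by rewrite /B /gen; case: (e2); apply: pull_ac.
have h3 : weq [:: a; b; c] ([:: V 0 a b; V 1 a c] ++ gen e3 t3 b c) (C ++ [:: V 0 a b; V 1 a c]).
  by rewrite /C /gen; case: (e3); apply: pull_bc.
step0 1 2 (pow_conj k2 rB h2).
step0 2 3 (pow_conj k3 rC h3).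
exact: weq_refl.
Qed.

(** The factors appear in the opposite order, but under the same [W], so that the two sides of a
    triangle move can be compared. *)
Lemma triangle_pull' : weq [:: a; b; c]
  (shift 1 (twist e3 k3 t3 b c) ++ twist e2 k2 t2 a c ++ shift 1 (twist e1 k1 t1 a b))
  (pow k3 C ++ pow k2 B ++ pow k1 A ++ W).
Proof.
have rpA := run_pow k1 rA; have rpB := run_pow k2 rB; have rpC := run_pow k3 rC.
rewrite /twist !shift_cat !shift_pow; norm_word.
have h2 : weq [:: a; b; c] ([:: V 1 b c] ++ gen e2 t2 a c) (B ++ [:: V 1 b c]).
  by rewrite /B /gen; case: (e2); apply: pull_ac'.
have h1 : weq [:: a; b; c] ([:: V 1 b c; V 0 a c] ++ shift 1 (gen e1 t1 a b)) (A ++ [:: V 1 b c; V 0 a c]).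
  by rewrite /A /gen; case: (e1); apply: pull_ab.
step0 1 2 (pow_conj k2 rB h2).
step0 2 3 (pow_conj k1 rA h1).
(* This is VR3, which brings the remaining virtual triangle to the form [W]. *)
step0 3 3 (weq_sym (detour_bc Virt a b c)).
exact: weq_refl.
Qed.
End Triangle.

Lemma triangle_cancel a b c u v :
  weq [:: a; b; c] (u ++ [:: V 0 a b; V 1 a c; V 0 b c])
    (v ++ [:: V 0 a b; V 1 a c; V 0 b c]) ->
  run u [:: a; b; c] = Some [:: a; b; c] ->
  run v [:: a; b; c] = Some [:: a; b; c] ->
  weq [:: a; b; c] u v.
Proof.
have H : weq [:: a; b; c] ([:: V 0 a b; V 1 a c; V 0 b c] ++ [:: V 0 c b; V 1 c a; V 0 b a]) [::].
  rewrite /=; step 2 2 0 (virtual_bigon b c).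
  step 1 2 1 (virtual_bigon a c).
  step 0 2 0 (virtual_bigon a b).
  exact: weq_refl.
move=> h ru rv.
have := weq_left ru (weq_sym H); rewrite cats0 => h1.
apply: weq_trans h1 _; rewrite catA.
have := weq_left rv H; rewrite cats0 => h2.
apply: weq_trans h2; rewrite catA.
exact: weq_right.
Qed.
End Pure.

Lemma run_twist n e k t (a b : 'I_n) : run (twist e k t a b) [:: a; b] = Some [:: b; a].
Proof. by rewrite /twist run_cat (run_pow _ (run_gen _ _ _ _)); run_tac. Qed.

Arguments twist : simpl never.
Arguments gen : simpl never.
Arguments far_gen : simpl never.
Arguments pow : simpl never.

(** * The relations of a triangle *)

Section Tri.
Variable n : nat.
Implicit Types (a b c d : 'I_n) (t : kind) (u v w : word n) (s : seq 'I_n).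
Implicit Types (A B C : bool -> word n) (e f : bool).

Definition unit_pair s A :=
  (forall e, run (A e) s = Some s) /\ (forall e, weq s (A e ++ A (~~ e)) [::]).

(** The moves give commutation of positive generators only; inverses then commute as in any
    group. *)
Lemma sign_comm s A v : unit_pair s A -> run v s = Some s ->
  weq s (v ++ A true) (A true ++ v) -> forall e, weq s (v ++ A e) (A e ++ v).
Proof.
move=> [rA iA] rv h [] //.
exact: inv_comm (rA true) (rA false) rv (iA true) (iA false) h.
Qed.

Lemma sign_comm2 s A B : unit_pair s A -> unit_pair s B ->
  weq s (B true ++ A true) (A true ++ B true) ->
  forall e f, weq s (B f ++ A e) (A e ++ B f).
Proof.
move=> uA uB h e f; have [rA _] := uA; have [rB _] := uB.
apply/weq_sym/(sign_comm uB (rA e))/weq_sym.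
exact: sign_comm uA (rB true) h e.
Qed.

(** At [false] the product is A^-1 B^-1, which inverts A B because the two commute. *)
Lemma unit_pair_cat s A B : unit_pair s A -> unit_pair s B ->
  weq s (B true ++ A true) (A true ++ B true) ->
  unit_pair s (fun e => A e ++ B e).
Proof.
move=> uA uB h; have AB := sign_comm2 uA uB h.
move: uA uB => [rA iA] [rB iB]; split=> e; first by rewrite run_cat rA /= rB.
have := rA e; have := rB e; have := rA (~~ e); have := rB (~~ e) => rB' rA' rBe rAe.
norm_word.
step0 2 2 (weq_sym (AB (~~ e) (~~ e))).
step0 1 2 (iB e).
exact: iA.
Qed.

Lemma unit_pair_neg s A : unit_pair s A -> unit_pair s (fun e => A (~~ e)).
Proof. by case=> rA iA; split=> e //. Qed.

Lemma unit_pair_pow k s A : unit_pair s A -> unit_pair s (fun e => pow k (A e)).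
Proof.
case=> rA iA; split=> e; first exact: run_pow.
elim: k => [|k IHk]; first exact: weq_refl.
have r1 := rA e; have r2 := rA (~~ e); have r3 := run_pow k r2; have r4 := run_pow k r1.
have h : weq s (A (~~ e) ++ pow k (A (~~ e))) (pow k (A (~~ e)) ++ A (~~ e)).
  by apply: pow_comm => //; apply: weq_refl.
rewrite !powS -!catA.
step0 2 2 h.
step0 1 2 IHk.
exact: iA.
Qed.

(* The hypotheses say that [A B] commutes with [C]. *)
Lemma pow_top s A B C e f k l :
  unit_pair s A -> unit_pair s B -> unit_pair s C ->
  weq s (B true ++ A true) (A true ++ B true) ->
  weq s (A true ++ B true ++ C true) (C true ++ B true ++ A true) ->
  weq s (pow k (A e) ++ pow k (B e) ++ pow l (C f))
        (pow l (C f) ++ pow k (B e) ++ pow k (A e)).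
Proof.
move=> uA uB uC BA ABC.
have uAB := unit_pair_cat uA uB BA.
have ABc := sign_comm2 uA uB BA e e.
have [[[rA _] [rB _]] [rC _]] := (uA, uB, uC).
have rAe := rA e; have rBe := rB e; have rCf := rC f.
have rA1 := rA true; have rB1 := rB true; have rC1 := rC true.
have h1 : weq s (C true ++ A true ++ B true) ((A true ++ B true) ++ C true).
  norm_word.
  step0 1 2 (weq_sym BA).
  exact: weq_sym.
have rAB : run (A e ++ B e) s = Some s by rewrite run_cat rAe.
have rpA := run_pow k rAe; have rpB := run_pow k rBe; have rpC := run_pow l rCf.
(* Since A B commutes with C, the power (A B)^k commutes with C^l; it equals A^k B^k because A and B
   commute. *)
have h2 := sign_comm2 uAB uC h1 e f.
have h3 := pow_comm k rAB rpC (weq_sym (pow_comm l rCf rAB (weq_sym h2))).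
have h4 := pow_mul k rAe rBe ABc.
have h5 := pow_comm k rAe rpB (weq_sym (pow_comm k rBe rAe (weq_sym ABc))).
apply: weq_sym.
step0 1 2 h5.
step0 1 2 (weq_sym h4).
step0 0 2 h3.
step0 0 1 h4.
exact: weq_refl.
Qed.

(* The hypotheses say that [A C^-1] commutes with [B]. *)
Lemma pow_middle s A B C e f k l :
  unit_pair s A -> unit_pair s B -> unit_pair s C ->
  weq s (C true ++ A true) (A true ++ C true) ->
  weq s (A true ++ B true ++ C true) (C true ++ B true ++ A true) ->
  weq s (pow k (A e) ++ pow l (B f) ++ pow k (C e))
        (pow k (C e) ++ pow l (B f) ++ pow k (A e)).
Proof.
move=> uA uB uC CA ABC.
have uC' := unit_pair_neg uC.
have [[[rA _] [rB _]] [rC iC]] := (uA, uB, uC).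
have rA1 := rA true; have rB1 := rB true; have rC1 := rC true; have rC0 := rC false.
have CA' : weq s (C false ++ A true) (A true ++ C false).
  exact/weq_sym/(sign_comm uC)/weq_sym.
have h : weq s (A true ++ C false ++ B true) (B true ++ C false ++ A true).
  step0 3 0 (weq_sym (iC true)).
  step0 0 2 (weq_sym CA').
  step0 1 3 ABC.
  step0 0 2 (iC false).
  step0 1 2 (weq_sym CA').
  exact: weq_refl.
(* This says that A^k C^-k commutes with B^l; multiplying by C^k on the left and on the right gives
   the claim. *)
have := pow_top e f k l uA uC' uB CA' h.
have [_ ip] := unit_pair_pow k uC.
have := ip (~~ e); rewrite negbK => i1; have i2 := ip e => H.
have r1 := run_pow k (rA e); have r2 := run_pow l (rB f); have r3 := run_pow k (rC e).
have r4 := run_pow k (rC (~~ e)).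
step0 0 0 (weq_sym i2).
have h5 : weq s (pow k (C (~~ e)) ++ pow k (A e)) (pow k (A e) ++ pow k (C (~~ e))).
  have h6 := sign_comm2 uA uC CA e (~~ e).
  by apply: pow_comm => //; apply/weq_sym/pow_comm => //; apply: weq_sym.
step0 1 2 h5.
step0 1 3 H.
step0 2 2 h5.
step0 3 2 i1.
exact: weq_refl.
Qed.

(* The hypotheses say that [B C] commutes with [A]. *)
Lemma pow_bottom s A B C e f k l :
  unit_pair s A -> unit_pair s B -> unit_pair s C ->
  weq s (C true ++ B true) (B true ++ C true) ->
  weq s (A true ++ B true ++ C true) (C true ++ B true ++ A true) ->
  weq s (pow l (A f) ++ pow k (B e) ++ pow k (C e))
        (pow k (C e) ++ pow k (B e) ++ pow l (A f)).
Proof.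
move=> uA uB uC CB ABC.
have [[[rA _] [rB _]] [rC _]] := (uA, uB, uC).
have r1 := rA true; have r2 := rB true; have r3 := rC true.
have h : weq s (B true ++ C true ++ A true) (A true ++ C true ++ B true).
  step0 0 2 (weq_sym CB).
  step0 0 3 (weq_sym ABC).
  step0 1 2 (weq_sym CB).
  exact: weq_refl.
have h1 : weq s (pow k (B e) ++ pow k (C e)) (pow k (C e) ++ pow k (B e)).
  have h6 := sign_comm2 uB uC CB e e.
  apply: weq_sym; apply: pow_comm (rB e) (run_pow k (rC e)) _.
  by apply/weq_sym/pow_comm => //; apply: weq_sym.
have r4 := run_pow l (rA f); have r5 := run_pow k (rB e); have r6 := run_pow k (rC e).
have H := pow_top e f k l uB uC uA CB h.
step0 1 2 h1.
apply: weq_trans (weq_sym H) _.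
step0 0 2 h1.
exact: weq_refl.
Qed.

(** The boolean [classical t] serves as exponent 0 or 1, so that moves with and without virtual
    crossings are treated at once. *)
Lemma cross_twist_classical t a b :
  weq [:: a; b] [:: X 0 t a b] (twist true (classical t) t a b).
Proof. by case: t; [exact: cross_twist | exact: cross_twist | exact: weq_refl]. Qed.

(** Both sides are pulled into products of pure tangles and the common virtual triangle is
    cancelled. Virtual crossings contribute exponent 0, so OC becomes a commutation of two
    generators. *)
Lemma triangle_rel t1 t2 t3 a b c :
  weq [:: a; b; c] (triangle 0 t1 t2 t3 a b c) (triangle' 0 t1 t2 t3 a b c) ->
  weq [:: a; b; c]
    (pow (classical t1) (gen true t1 a b) ++ pow (classical t2) (far_gen true t2 a b c)
       ++ pow (classical t3) (shift 1 (gen true t3 b c)))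
    (pow (classical t3) (shift 1 (gen true t3 b c))
       ++ pow (classical t2) (far_gen true t2 a b c) ++ pow (classical t1) (gen true t1 a b)).
Proof.
move=> h; set A := gen true t1 a b; set B := far_gen true t2 a b c.
set C := shift 1 (gen true t3 b c).
have rA : run A [:: a; b; c] = Some [:: a; b; c].
  exact: (run_right [:: c] (run_gen true t1 a b)).
have rB : run B [:: a; b; c] = Some [:: a; b; c] by exact: run_far_gen.
have rC : run C [:: a; b; c] = Some [:: a; b; c].
  by have := run_local [:: a] [::] (run_gen true t3 b c).
have rpA := run_pow (classical t1) rA; have rpB := run_pow (classical t2) rB.
have rpC := run_pow (classical t3) rC.
apply: triangle_cancel; last 2 first.
- by rewrite !run_cat rpA /= run_cat rpB.
- by rewrite !run_cat rpC /= run_cat rpB.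
norm_word.
apply: weq_trans (weq_sym (triangle_pull _ _ _ _ _ _ _ _ _ _ _ _)) _.
apply: weq_trans (triangle_pull' _ _ _ _ _ _ _ _ _ _ _ _).
have h1 := cross_twist_classical t1 a b.
have h2 := cross_twist_classical t2 a c.
have h3 := cross_twist_classical t3 b c.
have r1 : run (twist true (classical t1) t1 a b) [:: a; b] = Some [:: b; a].
  exact: run_twist.
have r2 : run (twist true (classical t2) t2 a c) [:: a; c] = Some [:: c; a].
  exact: run_twist.
have r3 : run (twist true (classical t3) t3 b c) [:: b; c] = Some [:: c; b].
  exact: run_twist.
step 0 1 0 (weq_sym h1).
step 1 1 1 (weq_sym h2).
step 2 1 0 (weq_sym h3).
apply: weq_trans h _; rewrite /triangle'.
step 0 1 1 h3.
step 1 1 0 h2.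
step 2 1 1 h1.
exact: weq_refl.
Qed.
End Tri.

(** * Multiplexed crossings as powers, and their triangles *)

Section Multi.
Variable n : nat.
Variable m : 'I_n -> int.
Implicit Types (a b c d : 'I_n) (t : kind) (u v w : word n) (s : seq 'I_n).

Definition over_component t a b := if t is OverRight then b else a.
Definition mult t a b : nat := if t is Virt then 0 else absz (m (over_component t a b)).
(** P^m v: the sign of the integer selects the generator or its inverse. For the integer 0 the sign
    bit is [false], but the exponent is 0. *)
Definition multi_cross t a b : word n :=
  twist (0 < m (over_component t a b))%R (mult t a b) t a b.

Lemma run_multi t a b : run (multi_cross t a b) [:: a; b] = Some [:: b; a].
Proof. exact: run_twist. Qed.

Lemma unit_gen t a b : unit_pair [:: a; b] (fun e => gen e t a b).
Proof. by split=> e; [apply: run_gen | apply: gen_inv]. Qed.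

Lemma unit_far_gen t a b c : unit_pair [:: a; b; c] (fun e => far_gen e t a b c).
Proof. by split=> e; [apply: run_far_gen | apply: far_gen_inv]. Qed.

Lemma unit_local p z s A : unit_pair s A ->
  unit_pair (p ++ s ++ z) (fun e => shift (size p) (A e)).
Proof.
case=> rA iA; split=> e; first exact: run_local.
by rewrite -shift_cat; apply: (weq_shift p z (iA e)).
Qed.

Lemma pow_bool (x : bool) w : pow x w = if x then w else [::].
Proof. by case: x => //; apply: cats0. Qed.

Lemma unit_gen_left t a b c : unit_pair [:: a; b; c] (fun e => gen e t a b).
Proof.
have := unit_local [::] [:: c] (unit_gen t a b); rewrite /unit_pair /=.
by case=> rA iA; split=> e; [have := rA e | have := iA e]; rewrite !shift0.
Qed.

Section Rel.
Variables (a b c : 'I_n).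
Let s := [:: a; b; c].
Let A t := fun e => gen e t a b.
Let B t := fun e => far_gen e t a b c.
Let C t := fun e => shift 1 (gen e t b c).

Let uA t : unit_pair s (A t). Proof. exact: unit_gen_left. Qed.
Let uB t : unit_pair s (B t). Proof. exact: unit_far_gen. Qed.
Let uC t : unit_pair s (C t). Proof. exact: (unit_local [:: a] [::] (unit_gen t b c)). Qed.

Let r3 t1 t2 t3 : classical t1 -> classical t2 -> classical t3 ->
  ~ (t1 = t3 /\ t2 = swap_kind t1) ->
  weq s (A t1 true ++ B t2 true ++ C t3 true) (C t3 true ++ B t2 true ++ A t1 true).
Proof.
move=> c1 c2 c3 nc.
have := @triangle_rel _ t1 t2 t3 a b c; rewrite !pow_bool c1 c2 c3; apply.
by apply: weq_move => [|z]; [constructor 2; apply: R3 | run_tac].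
Qed.

Lemma comm_a : weq s (B OverLeft true ++ A OverLeft true) (A OverLeft true ++ B OverLeft true).
Proof.
have := @triangle_rel _ OverLeft OverLeft Virt a b c.
rewrite !pow_bool [if classical Virt then _ else _]/= ?cats0 ?cat0s => h.
by apply/weq_sym/h/weq_move => [|z]; [constructor 4; apply: OC_a | run_tac].
Qed.

Let comm_b : weq s (C OverLeft true ++ A OverRight true) (A OverRight true ++ C OverLeft true).
Proof.
have := @triangle_rel _ OverRight Virt OverLeft a b c.
rewrite !pow_bool [if classical Virt then _ else _]/= ?cats0 ?cat0s => h.
by apply/weq_sym/h/weq_move => [|z]; [constructor 4; apply: OC_b | run_tac].
Qed.

Let comm_c : weq s (C OverRight true ++ B OverRight true) (B OverRight true ++ C OverRight true).
Proof.
have := @triangle_rel _ Virt OverRight OverRight a b c.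
rewrite !pow_bool [if classical Virt then _ else _]/= ?cats0 ?cat0s => h.
by apply/weq_sym/h/weq_move => [|z]; [constructor 4; apply: OC_c | run_tac].
Qed.

Lemma pow_comm2 (P Q : bool -> word n) e k :
  unit_pair s P -> unit_pair s Q ->
  weq s (Q true ++ P true) (P true ++ Q true) ->
  weq s (pow k (P e) ++ pow k (Q e)) (pow k (Q e) ++ pow k (P e)).
Proof.
move=> uP uQ h; have [[rP _] [rQ _]] := (uP, uQ).
apply: weq_sym; apply: (pow_comm _ (rP e)); first exact/run_pow/rQ.
apply/weq_sym; apply: (pow_comm _ (rQ e) (rP e)); apply: weq_sym.
exact: sign_comm2.
Qed.

(* The triangles of R3, VR3, VR4 and OC. *)
Definition passable t1 t2 t3 : bool :=
  match t1, t2, t3 with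
  | OverLeft, OverRight, OverLeft | OverRight, OverLeft, OverRight => false
  | OverLeft, OverRight, Virt | OverRight, OverLeft, Virt
  | OverRight, OverRight, Virt => false
  | OverLeft, Virt, _ => if t3 is Virt then true else false
  | OverRight, Virt, OverRight => false
  | Virt, OverLeft, OverLeft | Virt, OverLeft, OverRight
  | Virt, OverRight, OverLeft => false
  | _, _, _ => true
  end.

Lemma multi_triangle t1 t2 t3 : passable t1 t2 t3 ->
  weq s (multi_cross t1 a b ++ shift 1 (multi_cross t2 a c) ++ multi_cross t3 b c)
    (shift 1 (multi_cross t3 b c) ++ multi_cross t2 a c ++ shift 1 (multi_cross t1 a b)).
Proof.
move=> ok.
apply: weq_trans (triangle_pull _ _ _ _ _ _ _ _ _ _ _ _) _.
apply: weq_trans (weq_sym (triangle_pull' _ _ _ _ _ _ _ _ _ _ _ _)).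
set W := [:: V 0 a b; V 1 a c; V 0 b c].
suff h : weq s (pow (mult t1 a b) (A t1 (0 < m (over_component t1 a b))%R) ++
   pow (mult t2 a c) (B t2 (0 < m (over_component t2 a c))%R) ++
   pow (mult t3 b c) (C t3 (0 < m (over_component t3 b c))%R))
   (pow (mult t3 b c) (C t3 (0 < m (over_component t3 b c))%R) ++
   pow (mult t2 a c) (B t2 (0 < m (over_component t2 a c))%R) ++
   pow (mult t1 a b) (A t1 (0 < m (over_component t1 a b))%R)).
  by have := weq_right W h; rewrite -!catA.
have p0 w : pow 0 w = [::] by [].
(* In the R3 cases the top strand decides: [a] calls for [pow_top], [b] for [pow_middle], [c] for
   [pow_bottom]. Its two crossings carry equal exponents. OC leaves one commutation of powers, and
   VR3 and VR4 leave at most one factor. *)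
case: t1 t2 t3 ok => [] [] [] //= _; rewrite ?p0 ?cats0.
- by apply: pow_top (uA _) (uB _) (uC _) comm_a (r3 _ _ _ _) => // -[].
- by apply: pow_top (uA _) (uB _) (uC _) comm_a (r3 _ _ _ _) => // -[].
- exact: pow_comm2 (uA _) (uB _) comm_a.
- by apply: pow_bottom (uA _) (uB _) (uC _) comm_c (r3 _ _ _ _) => // -[].
- exact: weq_refl.
- by apply: pow_middle (uA _) (uB _) (uC _) comm_b (r3 _ _ _ _) => // -[].
- by apply: pow_middle (uA _) (uB _) (uC _) comm_b (r3 _ _ _ _) => // -[].
- by apply: pow_bottom (uA _) (uB _) (uC _) comm_c (r3 _ _ _ _) => // -[].
- exact: pow_comm2 (uA _) (uC _) comm_b.
- exact: weq_refl.
- exact: weq_refl.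
- exact: pow_comm2 (uB _) (uC _) comm_c.
- exact: weq_refl.
- exact: weq_refl.
- exact: weq_refl.
- exact: weq_refl.
Qed.
End Rel.

Lemma over_comm a b c e f :
  weq [:: a; b; c] (far_gen f OverLeft a b c ++ gen e OverLeft a b)
                   (gen e OverLeft a b ++ far_gen f OverLeft a b c).
Proof.
apply: (@sign_comm2 _ [:: a; b; c] (fun e => gen e OverLeft a b)
  (fun e => far_gen e OverLeft a b c)); first exact: unit_gen_left.
  exact: unit_far_gen.
exact: comm_a.
Qed.
End Multi.

(** * Zigzags and slides past extrema *)

Section Slides.
Variable n : nat.
Implicit Types (a b c d : 'I_n) (t : kind) (u v w : word n) (s : seq 'I_n).

(** Passing the virtual crossing turns the second power into the inverse of the first; VR2 removes
    the rest. *)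
Lemma twist_bigon e k t a b :
  weq [:: a; b] (twist e k t a b ++ twist e k (swap_kind t) b a) [::].
Proof.
have h : weq [:: a; b] ([:: V 0 a b] ++ gen e (swap_kind t) b a)
                       (gen (~~ e) t a b ++ [:: V 0 a b]).
  by have := gen_virt (~~ e) t a b; rewrite negbK => h; apply: weq_sym.
have r1 := run_pow k (run_gen e t a b).
rewrite /twist -!catA.
step0 1 2 (pow_conj k (run_gen (~~ e) t a b) h).
step0 0 2 ((unit_pair_pow k (unit_gen t a b)).2 e).
step0 0 2 (virtual_bigon a b).
exact: weq_refl.
Qed.

(** The maximum absorbs the crossings one at a time from the top, virtual and classical alike. *)
Lemma twist_kink e k t c :
  weq [:: c; c] (twist e k t c c ++ [:: (0, Cap c)]) [:: (0, Cap c)].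
Proof.
rewrite /twist -catA.
have rp := run_pow k (run_gen e t c c).
step0 1 2 (kink_cap Virt c).
elim: k {rp} => [|k IHk]; first exact: weq_refl.
rewrite powS -catA; have r1 := run_gen e t c c.
step0 1 2 IHk.
case: e {r1 IHk}; rewrite /gen /pure; norm_word.
  step 1 2 0 (kink_cap Virt c).
  exact: kink_cap.
step 1 2 0 (kink_cap (swap_kind t) c).
exact: kink_cap.
Qed.

(* The two halves of a capped strand are traversed in opposite directions, so  *)
(* that sliding a generator over the cap inverts it.                           *)
Lemma cap_gen e a b :
  weq [:: b; a; a] (gen e OverLeft b a ++ [:: (1, Cap a)])
                   (far_gen (~~ e) OverLeft b a a ++ [:: (1, Cap a)]).
Proof.
have h : weq [:: b; a; a] (gen false OverLeft b a ++ [:: (1, Cap a)])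
                   (far_gen true OverLeft b a a ++ [:: (1, Cap a)]).
  rewrite /gen /far_gen /pure /far_pure; norm_word.
  step 1 2 0 (weq_slide_max OverRight a b).
  step 2 0 1 (weq_sym (virtual_bigon a b)).
  step 3 2 0 (weq_sym (weq_slide_max Virt a b)).
  exact: weq_refl.
(* The other sign is obtained by inserting a generator and its inverse, using [over_comm] to reach
   the cap. *)
case: e => //.
have [rg ig] := unit_gen_left OverLeft b a a.
have [rf jf] := unit_far_gen OverLeft b a a.
have r1 := rg true; have r2 := rg false; have r3 := rf true; have r4 := rf false.
apply: weq_sym.
step0 0 0 (weq_sym (ig true)).
step0 1 2 (weq_sym (over_comm b a a false false)).
step0 2 2 h.
step0 1 2 (jf false).
exact: weq_refl.
Qed.

Lemma cup_gen e a b :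
  weq [:: a] ((1, Cup b) :: gen e OverLeft a b)
             ((1, Cup b) :: far_gen (~~ e) OverLeft a b b).
Proof.
have h : weq [:: a] ((1, Cup b) :: gen true OverLeft a b)
             ((1, Cup b) :: far_gen false OverLeft a b b).
  rewrite /gen /far_gen /pure /far_pure; norm_word.
  step 0 2 0 (weq_sym (weq_slide_min OverRight b a)).
  step 1 0 1 (weq_sym (virtual_bigon b a)).
  step 0 2 0 (weq_slide_min Virt b a).
  exact: weq_refl.
case: e => //.
have [rg ig] := unit_gen_left OverLeft a b b.
have [rf jf] := unit_far_gen OverLeft a b b.
have r1 := rg true; have r2 := rg false; have r3 := rf true; have r4 := rf false.
apply: weq_sym.
step 1 0 0 (weq_sym (ig true)).
step 0 2 0 h.
step 2 2 0 (weq_sym (over_comm a b b false true)).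
step 1 2 0 (jf false).
exact: weq_refl.
Qed.

Lemma weq_comm_pow k s u v :
  run u s = Some s -> run v s = Some s ->
  weq s (v ++ u) (u ++ v) -> weq s (pow k v ++ u) (u ++ pow k v).
Proof. by move=> ru rv h; apply/weq_sym/pow_comm => //; apply: weq_sym. Qed.

(** The capped strand is the underpass. Below the virtual crossing the generators become [OverLeft];
    each crosses the maximum by [cap_gen], with OC restoring the order, and the virtual crossing
    slides last. *)
Lemma twist_slide_max e k a b :
  weq [:: a; b; a] (twist e k OverRight a b ++ [:: (1, Cap a)])
    (shift 1 (twist e k OverLeft b a) ++ [:: (0, Cap a)]).
Proof.
have h1 : weq [:: a; b] ([:: V 0 a b] ++ gen (~~ e) OverLeft b a)
                        (gen e OverRight a b ++ [:: V 0 a b]).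
  exact: weq_sym (gen_virt e OverRight a b).
have h2 := weq_sym (pow_conj k (run_gen e OverRight a b) h1).
rewrite /twist; norm_word; rewrite shift_pow.
step 0 2 0 h2.
have h3 : weq [:: b; a; a] (pow k (gen (~~ e) OverLeft b a) ++ [:: (1, Cap a)])
    (pow k (far_gen e OverLeft b a a) ++ [:: (1, Cap a)]).
  have [rg ig] := unit_gen_left OverLeft b a a.
  have [rf jf] := unit_far_gen OverLeft b a a.
  have r1 := rg (~~ e); have r2 := rf e.
  elim: k {h2} => [|k IHk]; first exact: weq_refl.
  rewrite !powS.
  step0 1 2 IHk.
  step0 0 2 (weq_sym (weq_comm_pow k r1 r2 (over_comm b a a (~~ e) e))).
  have r3 := run_pow k r2.
  have := cap_gen (~~ e) a b; rewrite negbK => h.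
  step0 1 2 h.
  step0 0 2 (weq_comm_pow k r2 r2 (weq_refl _ _)).
  exact: weq_refl.
step 1 2 0 h3.
have h4 : weq [:: a; b; a] ([:: V 0 a b] ++ far_gen e OverLeft b a a)
    (shift 1 (gen e OverLeft b a) ++ [:: V 0 a b]).
  have h : weq [:: b; a; a] (V 0 b a :: shift 1 (gen e OverLeft b a))
      (far_gen e OverLeft b a a ++ [:: V 0 b a]).
    by rewrite /gen /far_gen; case: (e); apply: pull_ac.
  have [rf _] := unit_far_gen OverLeft b a a; have r1 := rf e.
  step 2 0 0 (weq_sym (virtual_bigon b a)).
  step 1 2 0 (weq_sym h).
  step 0 2 0 (virtual_bigon a b).
  exact: weq_refl.
have r4 : run (shift 1 (gen e OverLeft b a)) [:: a; b; a] = Some [:: a; b; a].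
  exact: (run_local [:: a] [::] (run_gen e OverLeft b a)).
step0 0 2 (pow_conj k r4 h4).
have r5 := run_pow k r4.
step0 1 2 (weq_slide_max Virt a b).
exact: weq_refl.
Qed.

(* The zigzags with [r] turns at each side, built by adding the turns farthest *)
(* to the right; [K0] and [K1] are the kinds of the even and odd intersections *)
(* and the overpass starts on the left in [zagL], on the right in [zagR].      *)
Fixpoint zagL K0 K1 r a b : word n :=
  if r is r'.+1 then
    (1, Cup b) :: zagL K0 K1 r' a b ++ [:: X 1 K1 a b; X 2 K0 a b; (1, Cap b)]
  else [:: X 0 K0 a b].

Fixpoint zagR K0 K1 r a b : word n :=
  if r is r'.+1 then
    [:: (0, Cup a); X 2 K0 a b; X 1 K1 a b] ++ zagR K0 K1 r' a b ++ [:: (2, Cap a)]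
  else [:: X 0 K0 a b].

Lemma run_zagL K0 K1 r a b : run (zagL K0 K1 r a b) [:: a; b] = Some [:: b; a].
Proof. by elim: r => [|r IHr]; run_tac. Qed.

Lemma run_zagR K0 K1 r a b : run (zagR K0 K1 r a b) [:: a; b] = Some [:: b; a].
Proof. by elim: r => [|r IHr]; run_tac. Qed.

(** The maximum of the overpass is dragged through the zigzag one intersection at a time, by planar
    moves only. *)
Lemma zag_slide_max K0 K1 r a b :
  weq [:: a; b; a] (zagL K0 K1 r a b ++ [:: (1, Cap a)])
    (shift 1 (zagR (swap_kind K0) (swap_kind K1) r b a) ++ [:: (0, Cap a)]).
Proof.
elim: r => [|r IHr]; first exact: weq_slide_max.
have rL := run_zagL K0 K1 r a b.
rewrite [zagL _ _ _ _ _]/= [zagR _ _ _ _ _]/=; norm_word.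
step 4 2 1 (@weq_exchange _ (Cap b) (Cap a) [::]).
step 3 2 2 (weq_slide_max K0 a b).
step 2 2 1 (@weq_exchange _ (Cross K1 a b) (Cross (swap_kind K0) b a) [::]).
step 3 2 1 (weq_slide_max K1 a b).
have h1 : weq [:: a; b; b; b; a]
    (zagL K0 K1 r a b ++ shift 2 [:: X 1 (swap_kind K0) b a; X 0 (swap_kind K1) b a])
    (shift 2 [:: X 1 (swap_kind K0) b a; X 0 (swap_kind K1) b a] ++ zagL K0 K1 r a b).
  apply: (@weq_far _ [:: a; b] [:: b; a] [:: b; b; a] [:: a; b; b] (zagL K0 K1 r a b)) => //.
  by run_tac.
step 1 3 0 h1.
step 3 2 0 IHr.
have rR := run_zagR (swap_kind K0) (swap_kind K1) r b a.
step 4 2 0 (@weq_exchange _ (Cap a) (Cap b) [:: b]).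
exact: weq_refl.
Qed.

(** Each turn yields one factor by planar moves: its minimum slides past the odd crossing and then
    cancels with its maximum. *)
Lemma zagR_pow K0 K1 r a b : weq [:: a; b] (zagR K0 K1 r a b)
  (pow r (pure K0 (swap_kind K1) a b) ++ [:: X 0 K0 a b]).
Proof.
elim: r => [|r IHr]; first exact: weq_refl.
rewrite powS [zagR _ _ _ _ _]/=; norm_word.
have rR := run_zagR K0 K1 r a b.
step 0 2 0 (@weq_exchange _ (Cup a) (Cross K0 a b) [::]).
step 1 2 0 (weq_slide_min K1 a b).
have h1 : weq [:: b; a; a; a]
    ((X 0 (swap_kind K1) b a :: zagR K0 K1 r a b) ++ shift 2 [:: (0, Cap a)])
    (shift 2 [:: (0, Cap a)] ++ (X 0 (swap_kind K1) b a :: zagR K0 K1 r a b)).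
  by apply: (@weq_far _ [:: b; a] [:: b; a] [:: a; a] [::] (_ :: zagR K0 K1 r a b)); run_tac.
step 2 3 0 h1.
step 1 2 1 (weq_zigzag_left a).
step 2 1 0 IHr.
exact: weq_refl.
Qed.

(* Sliding the overpass off the last turn of the zigzag leaves a generator on  *)
(* the turn before it, which commutes with the overcrossings below and is then *)
(* pulled back along the minimum.                                              *)
Lemma zagL_twist e k K0 K1 r a b :
  weq [:: a; b] [:: X 0 K0 a b] (twist e k OverLeft a b) ->
  pure K1 (swap_kind K0) a b = gen (~~ e) OverLeft a b ->
  weq [:: a; b] (zagL K0 K1 r a b) (twist e (r + k) OverLeft a b).
Proof.
move=> h0 hK; elim: r => // r IHr.
rewrite [zagL _ _ _ _ _]/=.
step 1 1 0 IHr.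
have h1 := weq_slide_max (swap_kind K0) b a; rewrite swap_kindK in h1.
have rt := run_twist e (r + k) OverLeft a b.
step 3 2 1 (weq_sym h1).
rewrite -[(1, Cup b) :: _]/([:: (1, Cup b)] ++ twist e (r + k) OverLeft a b ++
   shift 1 (pure K1 (swap_kind K0) a b) ++ [:: (2, Cap b)]) hK /twist.
rewrite ?addSn powS; set q := r + k.
have [rg _] := unit_gen_left OverLeft a b b; have rg1 := rg e; have rpg := run_pow q rg1.
have [rf _] := unit_far_gen OverLeft a b b; have rf1 := rf (~~ e).
have rc : run [:: (1, Cup b)] [:: a] = Some [:: a; b; b] by [].
have h2 : weq [:: a; b; b] (V 0 a b :: shift 1 (gen (~~ e) OverLeft a b))
    (far_gen (~~ e) OverLeft a b b ++ [:: V 0 a b]).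
  by rewrite /gen /far_gen; case: (~~ e); apply: pull_ac.
have rp2 := run_pow q (run_gen e OverLeft a b).
have rg2 := run_gen e OverLeft a b.
step 2 2 0 h2.
step 1 2 0 (weq_comm_pow q rf1 rg1 (weq_sym (over_comm a b b e (~~ e)))).
step 0 2 0 (weq_sym (cup_gen e a b)).
have h3 : weq [:: a; b; b; b]
    ((gen e OverLeft a b ++ pow q (gen e OverLeft a b) ++ [:: V 0 a b]) ++ shift 2 [:: (0, Cap b)])
    (shift 2 [:: (0, Cap b)] ++ (gen e OverLeft a b ++ pow q (gen e OverLeft a b) ++ [:: V 0 a b])).
  apply: (@weq_far _ [:: a; b] [:: b; a] [:: b; b] [::]); last by run_tac.
  by run_tac.
step 1 4 0 h3.
step 0 2 1 (weq_zigzag_left b).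
exact: weq_refl.
Qed.
End Slides.

(** * Multiplexing *)

Section Main.
Variable n : nat.
Variable m : 'I_n -> int.
Implicit Types (a b c d : 'I_n) (t : kind) (u v w : word n) (s p q z : seq 'I_n).

Lemma nseqSr (T : Type) k (x : T) : nseq k.+1 x = nseq k x ++ [:: x].
Proof. by elim: k => //= k ->. Qed.

Lemma zigzag_zagL (K : nat -> kind) r a b : (forall k, K k.+2 = K k) ->
  weq [:: a; b]
    (nseq r (1, Cup b) ++ [seq (0 + k, Cross (K k) a b) | k <- iota 0 r.*2.+1]
       ++ nseq r (1, Cap b))
    (zagL (K 0) (K 1) r a b).
Proof.
move=> K2; have Kd k : K k.*2 = K 0 by elim: k => // k IHk; rewrite doubleS K2.
have Kd1 k : K k.*2.+1 = K 1 by elim: k => // k IHk; rewrite doubleS K2.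
elim: r => [|r IHr]; first exact: weq_refl.
rewrite [zagL _ _ _ _ _]/= (nseqSr r (1, Cap b)) -[nseq r.+1 _]/((1, Cup b) :: nseq r _).
have -> : iota 0 r.+1.*2.+1 = iota 0 r.*2.+1 ++ [:: r.*2.+1; r.*2.+2].
  by rewrite -[[:: _; _]]/(iota (0 + r.*2.+1) 2) -iotaD; congr iota; lia.
rewrite map_cat [map _ [:: _; _]]/= Kd1 -doubleS Kd doubleS !add0n.
set Y := map _ _; set cups := nseq r (1, Cup b); set caps := nseq r (1, Cap b).
(* The inner maxima are lowered below the last two crossings, which isolates the smaller zigzag. *)
have h : weq (nseq r.*2.+1 b ++ [:: a; b; b])
  (caps ++ shift 1 [:: X 0 (K 1) a b; X 1 (K 0) a b])
  (shift r.*2.+1 [:: X 0 (K 1) a b; X 1 (K 0) a b] ++ caps).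
  have := @weq_far _ (nseq r.*2.+1 b) [:: b] [:: a; b; b] [:: b; b; a] caps
    [:: X 0 (K 1) a b; X 1 (K 0) a b].
  rewrite size_nseq; apply; last by run_tac.
  have := run_caps b r [:: b] [::]; rewrite cats0.
  exact.
have r1 : run ((1, Cup b) :: cups ++ Y) [:: a; b] = Some (nseq r.*2.+1 b ++ [:: a; b; b]).
  rewrite -cat_cons run_cat.
  have := run_cups b r.+1 [:: a] [:: b]; rewrite /cups => ->.
  rewrite -[LHS]/(run Y (a :: nseq r.+1.*2 b ++ [:: b])).
  have -> : nseq r.+1.*2 b ++ [:: b] = nseq r.*2.+1 b ++ [:: b; b].
    by rewrite (nseq_shift r.*2.+1 b [:: b]).
  exact: (@run_rightward _ K a b 0 r.*2.+1 0 [::] [:: b; b] erefl).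
rewrite [shift r.*2.+1 _]/= [shift 1 _]/= /= addn0 addn1 in h.
apply: (weq_rw0 (post := [:: (1, Cap b)]) (weq_sym h) r1); first by rewrite /= -!catA.
norm_word.
step 1 3 0 IHr.
exact: weq_refl.
Qed.

Lemma zigzag_zagR (K : nat -> kind) r a b : (forall k, K k.+2 = K k) ->
  weq [:: a; b]
    (nseq r (0, Cup a) ++ [seq (0 + (r.*2 - k), Cross (K k) a b) | k <- iota 0 r.*2.+1]
       ++ nseq r (2, Cap a))
    (zagR (K 0) (K 1) r a b).
Proof.
move=> K2; elim: r => [|r IHr]; first exact: weq_refl.
rewrite [zagR _ _ _ _ _]/= (nseqSr r (2, Cap a)) -[nseq r.+1 _]/((0, Cup a) :: nseq r _).
(* Coming from the right, the overpass meets the outermost turn first; [K2] reindexes what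
   follows. *)
rewrite -[iota 0 _]/(0 :: 1 :: iota (2 + 0) r.*2.+1) (iotaDl 2 0) 2!map_cons -map_comp.
rewrite (eq_map (g := fun k => (0 + (r.*2 - k), Cross (K k) a b))); last first.
  by move=> k /=; rewrite K2 doubleS !subSS.
rewrite !add0n !subn1 subn0 doubleS succnK.
set Y := map _ _; set cups := nseq r (0, Cup a); set caps := nseq r (2, Cap a).
have h : weq [:: a; a; a; b]
  (cups ++ [:: X r.*2.+2 (K 0) a b; X r.*2.+1 (K 1) a b])
  ([:: X 2 (K 0) a b; X 1 (K 1) a b] ++ cups).
  have := @weq_far _ [::] (nseq r.*2 a) [:: a; a; a; b] [:: a; b; a; a] cups
    [:: X 2 (K 0) a b; X 1 (K 1) a b].
  rewrite size_nseq [size [::]]/= shift0 !shift_cons shift_nil addn1 addn2; apply; last by run_tac.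
  by have := run_cups a r [::] [::]; rewrite /= cats0.
step 1 3 0 h.
step 3 3 0 IHr.
exact: weq_refl.
Qed.

Notation multi := (multi_cross m).

Lemma zigzag_kind_periodic (x : int) t k : zigzag_kind x t k.+2 = zigzag_kind x t k.
Proof. by rewrite /zigzag_kind /= negbK. Qed.

Lemma swap_zigzag_kind (x : int) t k :
  swap_kind (zigzag_kind x t k) = zigzag_kind x (swap_kind t) k.
Proof. by rewrite /zigzag_kind; case: ifP. Qed.

Lemma powSr k w : pow k w ++ w = pow k.+1 w.
Proof. by elim: k => [|k IHk]; rewrite powS ?cats0 // -catA IHk. Qed.

Lemma zagR_multi a b :
  weq [:: a; b] (zagR (zigzag_kind (m b) OverRight 0) (zigzag_kind (m b) OverRight 1)
                   (turns (m b)) a b) (multi OverRight a b).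
Proof.
apply: weq_trans (zagR_pow _ _ _ _ _) _.
rewrite /multi_cross /mult /over_component /zigzag_kind /=.
(* For positive integers there is one turn too few, and the final classical crossing P v supplies
   the missing factor. Otherwise the final crossing is virtual and the turns supply all factors. *)
case: (m b) => [[|k]|k]; rewrite /= /twist.
- exact: weq_refl.
- rewrite -powSr -catA -/(gen true OverRight a b).
  have r1 := run_pow k (run_gen true OverRight a b).
  step0 1 1 (cross_twist OverRight a b).
  by rewrite /twist -/(gen true OverRight a b) (_ : pow 1 _ = gen true OverRight a b) ?cats0; first exact: weq_refl.
- exact: weq_refl.
Qed.

Lemma zagL_multi a b :
  weq [:: a; b] (zagL (zigzag_kind (m a) OverLeft 0) (zigzag_kind (m a) OverLeft 1)
                   (turns (m a)) a b) (multi OverLeft a b).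
Proof.
rewrite /multi_cross /mult /over_component /zigzag_kind /=.
case: (m a) => [[|k]|k] /=.
- exact: weq_refl.
- by have := zagL_twist k (cross_twist OverLeft a b) erefl; rewrite addn1.
- by have := @zagL_twist _ false 0 Virt OverLeft k.+1 a b (weq_refl _ _) erefl; rewrite addn0.
Qed.

Lemma layer_multi t a b :
  weq [:: a; b] (multiplex_layer m (0, Cross t a b)) (multi t a b).
Proof.
case: t; last exact: weq_refl.
- apply: weq_trans (zagL_multi a b).
  by apply: zigzag_zagL; apply: zigzag_kind_periodic.
- apply: weq_trans (zagR_multi a b).
  by apply: zigzag_zagR; apply: zigzag_kind_periodic.
Qed.

(** For [OverRight] the cap joins the underpass and [twist_slide_max] applies. For [OverLeft] it
    joins the overpass, so the twist is first drawn as a zigzag again. *)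
Lemma multi_slide_max t a b :
  weq [:: a; b; a] (multi t a b ++ [:: (1, Cap a)])
    (shift 1 (multi (swap_kind t) b a) ++ [:: (0, Cap a)]).
Proof.
case: t; [|exact: twist_slide_max|exact: (weq_slide_max Virt)].
have r1 := run_multi m OverRight b a.
step 0 1 0 (weq_sym (zagL_multi a b)).
apply: weq_trans (zag_slide_max _ _ _ _ _) _; rewrite !swap_zigzag_kind.
have r2 := run_zagR (zigzag_kind (m a) OverRight 0) (zigzag_kind (m a) OverRight 1)
  (turns (m a)) b a.
step 0 1 1 (zagR_multi b a).
exact: weq_refl.
Qed.

Lemma multi_slide_min t a b :
  weq [:: b] ((0, Cup a) :: shift 1 (multi t a b))
    ((1, Cup a) :: multi (swap_kind t) b a).
Proof. by apply: slide_min_of_max; [exact: run_multi|exact: run_multi|exact: multi_slide_max]. Qed.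

Lemma multi_kink t c : weq [:: c; c] (multi t c c ++ [:: (0, Cap c)]) [:: (0, Cap c)].
Proof. exact: twist_kink. Qed.

Lemma multi_curl t c : weq [:: c] ((1, Cup c) :: multi t c c ++ [:: (1, Cap c)]) [::].
Proof.
have h := multi_slide_min (swap_kind t) c c; rewrite swap_kindK in h.
have r1 := run_multi m (swap_kind t) c c.
step 0 2 0 (weq_sym h).
step 1 2 1 (multi_kink (swap_kind t) c).
exact: weq_zigzag_left.
Qed.

Lemma multi_bigon t a b : weq [:: a; b] (multi t a b ++ multi (swap_kind t) b a) [::].
Proof.
by case: t; [exact: twist_bigon | exact: twist_bigon | exact: (weq_bigon Virt)].
Qed.

(** * From single crossings to words and moves *)

Definition multi_layer (l : layer n) : word n :=
  if l is (i, Cross t a b) then shift i (multi t a b) else [:: l].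
Definition multi_word w : word n := flatten (map multi_layer w).

Lemma multiplex_layer_shift k (l : layer n) :
  multiplex_layer m (k + l.1, l.2) = shift k (multiplex_layer m l).
Proof.
case: l => i [c|c|[] a b] //; rewrite /multiplex_layer !shift_cat !shift_nseq ?addnS.
  by congr (_ ++ (_ ++ _)); rewrite /shift -map_comp; apply: eq_map => j /=; rewrite addnA.
by congr (_ ++ (_ ++ _)); rewrite /shift -map_comp; apply: eq_map => j /=; rewrite addnA.
Qed.

Lemma run_layer (l : layer n) w s s' : run (l :: w) s = Some s' ->
  exists p q, [/\ size p = l.1, s = p ++ src l.2 ++ q & run w (p ++ tgt l.2 ++ q) = Some s'].
Proof.
rewrite -[run _ _]/(obind (run w) (Defs.apply l s)).
case ls: (Defs.apply l s) => [s1|] // ws.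
by have [p [q [sp -> e1]]] := applyP ls; exists p, q; rewrite -e1.
Qed.

Lemma weq_ext s z u v : weq s u v -> weq (s ++ z) u v.
Proof. by move=> /(weq_shift [::] z); rewrite !shift0. Qed.

Lemma multiplex_layer_multi (l : layer n) s s' : Defs.apply l s = Some s' ->
  weq s (multiplex_layer m l) (multi_layer l).
Proof.
case: l => i [c|c|t a b] ls; [exact: weq_refl|exact: weq_refl|].
have [p [q [sp -> _]]] := applyP ls; rewrite [_.1]/= in sp.
have -> : multiplex_layer m (i, Cross t a b) = shift i (multiplex_layer m (0, Cross t a b)).
  by have := multiplex_layer_shift i (0, Cross t a b); rewrite [_ + _]addn0.
by rewrite -sp; apply: (weq_shift p q (layer_multi t a b)).
Qed.

Lemma multiplex_word_multi w s s' : run w s = Some s' ->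
  weq s (multiplex_word m w) (multi_word w).
Proof.
elim: w s => [|l w IHw] s; first by move=> _; apply: weq_refl.
rewrite -[run _ _]/(obind (run w) (Defs.apply l s)).
case ls: (Defs.apply l s) => [s1|] // ws.
apply: (weq_trans (v := multiplex_layer m l ++ multi_word w)).
  by apply: weq_left (IHw _ ws); apply: run_multiplex_layer ls.
exact: weq_right (multiplex_layer_multi ls).
Qed.

Lemma run_multi_word w s s' : run w s = Some s' -> run (multi_word w) s = Some s'.
Proof.
move=> ws; have := weq_run [::] (multiplex_word_multi ws); rewrite cats0 => <-.
exact: run_multiplex.
Qed.

Lemma multi_word_shift k w : multi_word (shift k w) = shift k (multi_word w).
Proof.
elim: w => // -[i e] w IHw; rewrite /multi_word /= -/(multi_word _) IHw shift_cat.
by congr (_ ++ _); case: e => //= t a b; rewrite shift_shift.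
Qed.

Lemma multi_word_cat u v : multi_word (u ++ v) = multi_word u ++ multi_word v.
Proof. by rewrite /multi_word map_cat flatten_cat. Qed.

Lemma multi_word1 i (e : event n) : multi_word [:: (i, e)] = shift i (multi_word [:: (0, e)]).
Proof. by rewrite -multi_word_shift shift_cons addn0. Qed.

Definition translates u v : Prop :=
  forall s s', run u s = Some s' -> weq s (multi_word u) (multi_word v).

(** The left word is nonempty so that its first layer guarantees at least [i] strands to split off;
    the empty word runs on any bottom. *)
Lemma translates_shift i (l : layer n) w v :
  translates (l :: w) v -> translates (shift i (l :: w)) (shift i v).
Proof.
move=> h s s' r; have [p [q [sp es _]]] := run_layer r.
have si : size (take i s) = i.
  by rewrite size_takel // es size_cat sp /= -addnA leq_addr.
move: r; rewrite -(cat_take_drop i s) !multi_word_shift.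
move: (take i s) (drop i s) si => p0 s2 <-; rewrite run_shift.
case r: (run (l :: w) s2) => [s1|] // _.
by have := weq_shift p0 [::] (h _ _ r); rewrite cats0.
Qed.

(** Multiplexing a layer changes neither its bottom nor its top strands, so distant layers become
    distant words and [weq_far] applies. *)
Lemma translates_exchange k (e f : event n) :
  translates [:: (0, e); (size (tgt e) + k, f)] [:: (size (src e) + k, f); (0, e)].
Proof.
move=> s s' /run_layer[p [q [+ -> ]]]; case: p => // _ /run_layer[p [q' [sp e1 _]]].
rewrite /= in sp e1 *.
have eq : q = drop (size (tgt e)) p ++ src f ++ q'.
  have := congr1 (drop (size (tgt e))) e1; rewrite drop_size_cat // => ->.
  rewrite drop_cat; case: ltnP => // h.
  have -> : size (tgt e) = size p by lia.
  by rewrite subnn drop0 drop_size.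
set r := drop _ p in eq; have sr : size r = k by rewrite size_drop sp addKn.
rewrite -[in Z in weq _ Z _]cat1s -[in Z in weq _ _ Z]cat1s !multi_word_cat.
rewrite (multi_word1 (_ + _) f) (multi_word1 (_ + _) f) -!(shift_shift _ k).
rewrite eq -sr.
have he : run (multi_word [:: (0, e)]) (src e) = Some (tgt e).
  by apply: run_multi_word; have := apply_cat e [::] [::]; rewrite run1 !cats0.
have hf : run (multi_word [:: (0, f)]) (src f) = Some (tgt f).
  by apply: run_multi_word; have := apply_cat f [::] [::]; rewrite run1 !cats0.
exact: weq_far he (run_local r q' hf).
Qed.

Lemma run0 (e : event n) w s s' : run ((0, e) :: w) s = Some s' ->
  exists q, s = src e ++ q /\ run w (tgt e ++ q) = Some s'.
Proof. by move=> /run_layer[[|y p] [q [// _ -> r]]]; exists q. Qed.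

Lemma run_at1 (e : event n) w x s s' : run ((1, e) :: w) (x :: s) = Some s' ->
  exists q, s = src e ++ q /\ run w (x :: tgt e ++ q) = Some s'.
Proof. by move=> /run_layer[[|y [|y' p]] [q [// _ [<- ->] r]]]; exists q. Qed.

Lemma translates_local s u v :
  (forall s1 s', run u s1 = Some s' -> exists z, s1 = s ++ z) ->
  weq s (multi_word u) (multi_word v) -> translates u v.
Proof. by move=> h uv s1 s' /h[z ->]; apply: weq_ext. Qed.

Lemma translates_zigzag_left c : translates [:: (0, Cup c); (1, Cap c)] [::].
Proof.
apply: (@translates_local [:: c]); last exact: weq_zigzag_left.
by move=> s s' /run0[q [-> /run_at1[q' [[->] _]]]]; exists q'.
Qed.

Lemma translates_zigzag_right c : translates [:: (1, Cup c); (0, Cap c)] [::].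
Proof.
apply: (@translates_local [:: c]); last exact: weq_zigzag_right.
move=> [|x s] s' //.
by move=> /run_at1[q [-> /run0[q' [[-> _] _]]]]; exists q.
Qed.

Lemma translates_slide_max t a b : translates [:: X 0 t a b; (1, Cap a)]
  [:: X 1 (swap_kind t) b a; (0, Cap a)].
Proof.
apply: (@translates_local [:: a; b; a]).
  by move=> s s' /run0[q [-> /run_at1[q' [[->] _]]]]; exists q'.
by have := multi_slide_max t a b; rewrite /multi_word /= shift0.
Qed.

Lemma translates_slide_min t a b : translates [:: (0, Cup a); X 1 t a b]
  [:: (1, Cup a); X 0 (swap_kind t) b a].
Proof.
apply: (@translates_local [:: b]).
  by move=> s s' /run0[q [-> /run_at1[q' [[->] _]]]]; exists q'.
by have := multi_slide_min t a b; rewrite /multi_word /= shift0 !cats0.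
Qed.

Lemma translates_curl t c : translates (curl 0 t c) [::].
Proof.
apply: (@translates_local [:: c]).
  move=> [|x s] s' //.
  by move=> /run_at1[q [-> /run0[q' [[-> _] _]]]]; exists q.
by have := multi_curl t c; rewrite /multi_word /= shift0.
Qed.

Lemma translates_bigon t a b : translates (bigon 0 t a b) [::].
Proof.
apply: (@translates_local [:: a; b]).
  by move=> s s' /run0[q [-> _]]; exists q.
by have := multi_bigon t a b; rewrite /multi_word /= !shift0 cats0.
Qed.

Lemma translates_triangle t1 t2 t3 a b c : passable t1 t2 t3 ->
  translates (triangle 0 t1 t2 t3 a b c) (triangle' 0 t1 t2 t3 a b c).
Proof.
move=> ok; apply: (@translates_local [:: a; b; c]).
  by move=> s s' /run0[q [-> /run_at1[q' [[->] _]]]]; exists q'.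
by have := @multi_triangle _ m a b c t1 t2 t3 ok; rewrite /multi_word /= !shift0 !cats0.
Qed.

Lemma translates_welded_move u v : welded_move u v -> translates u v.
Proof.
have sh i l w w' : translates (l :: w) w' -> forall w1 w1',
    w1 = shift i (l :: w) -> w1' = shift i w' -> translates w1 w1'.
  by move=> h w1 w1' -> ->; apply: translates_shift.
have tri i t1 t2 t3 a b c : passable t1 t2 t3 ->
    translates (triangle i t1 t2 t3 a b c) (triangle' i t1 t2 t3 a b c).
  by move=> /translates_triangle h; apply: (sh i _ _ _ (h a b c));
     rewrite /triangle /triangle' !shift_cons addn0 addn1.
have crl i t c : translates (curl i t c) [::].
  have h : translates [:: _; _; _] _ := @translates_curl t c.
  by apply: (sh i _ _ _ h); rewrite /curl ?shift_cons ?addn0 ?addn1.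
have big i t a b : translates (bigon i t a b) [::].
  have h : translates [:: _; _] _ := @translates_bigon t a b.
  by apply: (sh i _ _ _ h); rewrite /bigon ?shift_cons ?addn0.
case=> [[]|[]|[]|[]]; try by move=> *; apply: tri => //.
- move=> i k e f; apply: (sh i _ _ _ (@translates_exchange k e f));
  by rewrite !shift_cons addn0 addnA.
- by move=> i c; apply: (sh i _ _ _ (@translates_zigzag_right c));
  rewrite ?shift_cons ?addn0 ?addn1.
- by move=> i c; apply: (sh i _ _ _ (@translates_zigzag_left c));
  rewrite ?shift_cons ?addn0 ?addn1.
- by move=> i t a b; apply: (sh i _ _ _ (@translates_slide_max t a b));
  rewrite ?shift_cons ?addn0 ?addn1.
- by move=> i t a b; apply: (sh i _ _ _ (@translates_slide_min t a b));
  rewrite ?shift_cons ?addn0 ?addn1.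
- by move=> i t c _; apply: crl.
- by move=> i t a b _; apply: big.
- move=> i t1 t2 t3 a b c c1 c2 c3 nc; apply: tri.
  (* The two cyclic patterns excluded by R3 are the only all-classical triples that [passable]
     rejects. *)
  by case: t1 t2 t3 c1 c2 c3 nc => [] [] [] //= _ _ _ []; split.
- by move=> i c; apply: crl.
- by move=> i a b; apply: big.
- by move=> i [] a b c // _; apply: tri.
- by move=> i [] a b c // _; apply: tri.
Qed.

Lemma multiplex_welded_step w w' : welded_step w w' ->
  clos_refl_sym_trans _ (@welded_step n) (multiplex_word m w) (multiplex_word m w').
Proof.
move=> [cw [cw' [p [q [u [v [uv [ew ew']]]]]]]].
have cW := multiplex_closed m cw.
apply: (fun h => (weq_welded h cW).2).
move: cw cw'; rewrite /closed_word ew ew' !multiplex_cat !run_cat.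
case ps: (run p [::]) => [s|] //=; rewrite !run_cat.
case us: (run u s) => [s1|] //= _; case vs: (run v s) => [s2|] //= _.
(* The strands [s] above [p] are unchanged by multiplexing, so the translated move still fits
   between the multiplexed [p] and [q]. *)
apply: weq_left (run_multiplex m ps) (weq_right _ _).
apply: weq_trans (multiplex_word_multi us) _.
apply: weq_trans (weq_sym (multiplex_word_multi vs)).
exact: translates_welded_move uv _ _ us.
Qed.

End Main.

Theorem theorem2p1 (n : nat) (hn : 0 < n) (D D' : ordered_diagram n)
    (h : welded_isotopic D D') (m : 'I_n -> int) :
  welded_isotopic (multiplex m D) (multiplex m D').
Proof.
rewrite /welded_isotopic /=.
elim: h => [w w' /(multiplex_welded_step m) //|w|w w' _|w1 w2 w3 _ + _].
- exact: rst_refl.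
- exact: rst_sym.
- exact: rst_trans.
Qed.
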